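(* Let $(M,g)$ be a closed surface (dimension $2$) with a fixed Riemannian metric $g$ whose scalar curvature satisfies $R>0$. If $f:M\times[0,T)\to\mathbb{R}$ is a positive solution to the nonlinear heat equation $$\frac{\partial}{\partial t}f=\Delta f-f\ln f ,$$ then for all $t\in(0,T)$, $$\frac{\partial}{\partial t}\ln f-|\nabla\ln f|^2+\ln f+\frac1t=\Delta\ln f+\frac1t\ge 0 .$$
   Context: A closed surface is a compact 2-dimensional manifold without boundary. $\Delta$, $\nabla$ and $|\cdot|$ are the Laplace–Beltrami operator, the gradient and the norm of $g$. Solutions are smooth. *)

(* Defs.v *)
From HB Require Import structures.
From mathcomp Require Import all_boot all_order all_algebra.
From mathcomp Require Import all_classical all_reals all_analysis.

Set Implicit Arguments.
Unset Strict Implicit.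
Unset Printing Implicit Defensive.

Import Order.TTheory GRing.Theory Num.Theory.
Import numFieldNormedType.Exports.

Local Open Scope classical_set_scope.
Local Open Scope ring_scope.

Section smooth.
Context {R : realType} {V W : normedModType R}.
Implicit Types (F G : V -> W) (U A : set V).

Definition iter_derive (vs : seq V) F : V -> W :=
  foldr (fun v G => 'D_v G) F vs.

(* C^oo on an open set U, for V of finite dimension: every iterated directional
   derivative exists and is continuous at each point of U. Only meaningful for
   open U, since the derivatives are two-sided. *)
Definition smooth_open U F := forall (vs : seq V) (x : V), U x ->
  (forall v, derivable (iter_derive vs F) x v) /\
  {for x, continuous (iter_derive vs F)}.

(* Smoothness on an arbitrary subset A of V: F agrees on A, locally around each
   point of A, with a function that is C^oo on an open set. It is used with A
   the product of an open set and [0, T[, where it means smooth up to time 0. *)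
Definition smooth_subset A F := forall x, A x ->
  exists U G, [/\ open U, U x, smooth_open U G &
                 forall y, A y -> U y -> F y = G y].

End smooth.

(* A smooth n-dimensional atlas without boundary on M. The inverse charts are
   total functions, whose values outside the chart images are irrelevant. *)
Record atlas (R : realType) (n : nat) (M : topologicalType) := Atlas {
  chart_index : Type;
  chart_dom : chart_index -> set M;
  chart : chart_index -> M -> 'rV[R]_n;
  chart_inv : chart_index -> 'rV[R]_n -> M;
  chart_dom_open : forall i, open (chart_dom i);
  chart_cod_open : forall i, open (chart i @` chart_dom i);
  chartK : forall i p, chart_dom i p -> chart_inv i (chart i p) = p;
  chart_continuous : forall i p, chart_dom i p ->
    {for p, continuous (chart i)};
  chart_inv_continuous : forall i x, (chart i @` chart_dom i) x ->
    {for x, continuous (chart_inv i)};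
  chart_cover : forall p, exists i, chart_dom i p;
  chart_transition : forall i j,
    smooth_open (chart i @` (chart_dom i `&` chart_dom j))
                (chart j \o chart_inv i)
}.

Definition chart_cod (R : realType) n (M : topologicalType)
    (A : atlas R n M) (i : chart_index A) : set 'rV[R]_n :=
  chart i @` chart_dom i.

(* The tensors below are computed at p in this chosen chart; scalars obtained
   from them do not depend on the choice. *)
Definition chart_at (R : realType) n (M : topologicalType)
    (A : atlas R n M) (p : M) : chart_index A :=
  projT1 (cid (chart_cover A p)).

(* A Riemannian metric, given by its matrices (g_ab) in the charts. With the
   row-vector convention ('J F x) a c is the a-th partial derivative of the
   c-th component of F, so that metric_compat is the transformation law
   g_ab = (d y^c / d x^a) (d y^d / d x^b) g'_cd. *)
Record riemannian_metric (R : realType) (n : nat) (M : topologicalType)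
    (A : atlas R n M) := RiemannianMetric {
  metric_coef : chart_index A -> 'rV[R]_n -> 'M[R]_n;
  metric_smooth : forall i, smooth_open (chart_cod i) (metric_coef i);
  metric_sym : forall i x, chart_cod i x ->
    (metric_coef i x)^T = metric_coef i x;
  metric_posdef : forall i x, chart_cod i x -> forall v : 'rV[R]_n, v != 0 ->
    0 < (v *m metric_coef i x *m v^T) 0 0;
  metric_compat : forall i j p, chart_dom i p -> chart_dom j p ->
    let Jac := 'J (chart j \o chart_inv i) (chart i p) in
    metric_coef i (chart i p) = Jac *m metric_coef j (chart j p) *m Jac^T
}.

Section local_formulas.
Context {R : realType} {n : nat}.
Variable G : 'rV[R]_n -> 'M[R]_n.
Implicit Types (u : 'rV[R]_n -> R) (X : 'rV[R]_n -> 'rV[R]_n) (x : 'rV[R]_n).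

Definition partial (a : 'I_n) u x : R := 'D_(delta_mx 0 a) u x.

(* Levi-Civita connection:
   Gamma^k_ij = (1/2) g^kl (d_i g_jl + d_j g_il - d_l g_ij) *)
Definition christoffel (k i j : 'I_n) x : R :=
  2^-1 * \sum_l invmx (G x) k l *
    (partial i (fun y => G y j l) x + partial j (fun y => G y i l) x
     - partial l (fun y => G y i j) x).

(* R^l_ijk, the components of R(X, Y)Z = D_X D_Y Z - D_Y D_X Z - D_[X,Y] Z:
   R(d_i, d_j) d_k = R^l_ijk d_l *)
Definition riemann (l i j k : 'I_n) x : R :=
  partial i (christoffel l j k) x - partial j (christoffel l i k) x
  + \sum_m (christoffel l i m x * christoffel m j k x
            - christoffel l j m x * christoffel m i k x).

(* With this contraction round spheres have positive curvature. *)
Definition ricci (j k : 'I_n) x : R := \sum_i riemann i i j k x.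

Definition local_scalar_curvature x : R :=
  \sum_j \sum_k invmx (G x) j k * ricci j k x.

Definition local_grad u x : 'rV[R]_n :=
  \row_i \sum_j invmx (G x) i j * partial j u x.

(* div X = D_i X^i = d_i X^i + Gamma^i_ij X^j *)
Definition local_div X x : R :=
  \sum_i (partial i (fun y => X y 0 i) x
          + \sum_j christoffel i i j x * X x 0 j).

Definition local_laplacian u x : R := local_div (local_grad u) x.

Definition local_norm x (v : 'rV[R]_n) : R := Num.sqrt ((v *m G x *m v^T) 0 0).

End local_formulas.

Section riemannian_operators.
Context {R : realType} {n : nat} {M : topologicalType} {A : atlas R n M}.
Variable g : riemannian_metric A.
Implicit Types (u : M -> R) (p : M).

Definition scalar_curvature p : R :=
  let i := chart_at A p in local_scalar_curvature (metric_coef g i) (chart i p).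

Definition laplacian u p : R :=
  let i := chart_at A p in
  local_laplacian (metric_coef g i) (u \o chart_inv i) (chart i p).

(* A tangent vector at p is represented by its components in chart_at A p. *)
Definition grad u p : 'rV[R]_n :=
  let i := chart_at A p in
  local_grad (metric_coef g i) (u \o chart_inv i) (chart i p).

Definition tangent_norm p (v : 'rV[R]_n) : R :=
  let i := chart_at A p in local_norm (metric_coef g i) (chart i p) v.

End riemannian_operators.

(* f : M x [0, T[ -> R is smooth; T may be +oo. *)
Definition smooth_spacetime (R : realType) n (M : topologicalType)
    (A : atlas R n M) (T : \bar R) (f : M -> R -> R) :=
  forall i : chart_index A,
    smooth_subset
      (chart_cod i `*` [set t : R | 0 <= t /\ (t%:E < T)%E])
      (fun z : 'rV[R]_n * R => f (chart_inv i z.1) z.2).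

(* Main.v *)
(* With u = ln f the equation becomes u_t = Lap u + |grad u|^2 - u. By the Bochner
   formula, in which Ric = (R/2) g in dimension 2, and by
   |Hess u|^2 >= (Lap u)^2 / 2, the function Q = Lap u satisfies
   Q_t >= Lap Q + 2 <grad u, grad Q> + Q^2 - Q. If t Q + 1 had a negative minimum
   on M x [0, t0], it would be attained at a time t > 0, where grad Q = 0,
   Lap Q >= 0 and (t Q)_t <= 0; but there
   (t Q)_t >= Q + t (Q^2 - Q) = Q (1 + t Q) - t Q > 0. *)
Require Import Defs.
From HB Require Import structures.
From mathcomp Require Import all_boot all_order all_algebra.
From mathcomp Require Import all_classical all_reals all_analysis.
From mathcomp Require Import ring lra.
Set Implicit Arguments.
Unset Strict Implicit.
Unset Printing Implicit Defensive.
Import Order.TTheory GRing.Theory Num.Theory.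
Import numFieldNormedType.Exports.
Local Open Scope classical_set_scope.
Local Open Scope ring_scope.

(** * Directional derivatives *)

(** The formal obstacle is that [laplacian g u p] is evaluated in [chart_at A p], a chart that may
    jump as [p] moves, so not even the continuity of Q is visible from its definition. It is removed
    by proving that the coordinate Laplacian is the same in all charts; near a given point Q is then
    one smooth expression in one chart. Inside that chart, Bochner's formula uses only that the
    inverse metric [h] is symmetric and parallel and that the Christoffel symbols are symmetric:
    every curvature term comes from commuting two derivatives. The evolution of Q is found by
    applying the Laplacian to the equation for u. This is legitimate because [g] does not depend on
    time and because space and time derivatives are directional derivatives on one product space,
    where they commute. The factor t gives t Q + 1 the value 1 at time 0, so no information on the
    initial data is needed there beyond continuity. That continuity comes from the local smooth
    extensions of [f] across time 0; the equation itself is used at positive times only. The minimum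
    may lie at the final time, so in time only earlier values can be compared with it. *)

Section directional.
Context {R : realType} {V : normedModType R}.
Implicit Types (F : V -> R) (U : set V) (x v w : V).

(** The two difference quotients are the same function of [h], so existence and value of the limit
    transfer together, without a chain rule and without differentiability of [F]. *)
Lemma is_derive_line (W : normedModType R) (F : V -> W) x v (s : R) :
  derivable F (x + s *: v) v ->
  is_derive s 1 (fun s : R => F (x + s *: v)) ('D_v F (x + s *: v)).
Proof.
have E : (fun h : R => h^-1 *: (((fun s => F (x + s *: v)) \o shift s) (h *: 1)
            - F (x + s *: v)))
       = (fun h : R => h^-1 *: ((F \o shift (x + s *: v)) (h *: v)
            - F (x + s *: v))).
  apply/funext => h /=; congr (_ *: (F _ - _)).
  by rewrite [h *: 1]mulr1 scalerDl addrCA.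
by move=> d; split; rewrite /derivable /derive /= E.
Qed.

Lemma is_derive_translate (W : normedModType R) (F : V -> W) x v c :
  derivable F (x + c) v -> is_derive x v (fun y => F (y + c)) ('D_v F (x + c)).
Proof.
have E : (fun h : R => h^-1 *: (((fun y => F (y + c)) \o shift x) (h *: v)
            - F (x + c)))
       = (fun h : R => h^-1 *: ((F \o shift (x + c)) (h *: v) - F (x + c))).
  by apply/funext => h /=; rewrite addrA.
by move=> d; split; rewrite /derivable /derive /= E.
Qed.

Lemma derive_addf F G x v dF dG : is_derive x v F dF -> is_derive x v G dG ->
  is_derive x v (fun y => F y + G y) (dF + dG).
Proof. exact: is_deriveD. Qed.

Lemma derive_oppf F x v dF : is_derive x v F dF ->
  is_derive x v (fun y => - F y) (- dF).
Proof. exact: is_deriveN. Qed.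

Lemma derive_mulf F G x v dF dG : is_derive x v F dF -> is_derive x v G dG ->
  is_derive x v (fun y => F y * G y) (dF * G x + F x * dG).
Proof.
move=> hF hG; apply: (is_derive_eq (is_deriveM hF hG)).
by rewrite addrC; congr (_ + _); rewrite mulrC.
Qed.

Lemma derive_cstf (c : R) x v : is_derive x v (fun=> c) 0.
Proof. exact: is_derive_cst. Qed.

Lemma derive_invf F x v dF : F x != 0 -> is_derive x v F dF ->
  is_derive x v (fun y => (F y)^-1) (- ((F x)^-1 * (F x)^-1 * dF)).
Proof.
move=> F0 [hF <-]; split; first exact: derivableV.
by rewrite deriveV// expr2 invfM scaleNr.
Qed.

(** Since [F] is only derivable along [v], the chain rule is applied in one variable, to the
    restriction of [F] to the line through [x], at parameter 0. *)
Lemma derive_comp1 F (f : R -> R) x v dF df : is_derive x v F dF ->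
  is_derive (F x) 1 f df -> is_derive x v (fun y => f (F y)) (df * dF).
Proof.
move=> [hF <-] hf.
have E0 : F x = F (x + 0 *: v) by rewrite scale0r addr0.
have hF' : derivable F (x + 0 *: v) v by rewrite scale0r addr0.
have h1 := is_derive_line hF'.
rewrite [in 'D_v F _]scale0r [in 'D_v F _]addr0 in h1.
rewrite E0 in hf.
have h2 := @is_derive1_comp _ f (fun s : R => F (x + s *: v)) 0 _ _ hf h1.
have E : (fun h : R => h^-1 *: (((fun s => f (F (x + s *: v))) \o shift 0) (h *: 1)
            - f (F (x + 0 *: v))))
       = (fun h : R => h^-1 *: (((fun y => f (F y)) \o shift x) (h *: v)
            - f (F x))).
  apply/funext => h /=; rewrite scale0r addr0 [h *: 1]mulr1 addr0.
  by rewrite [x + _]addrC.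
case: h2; rewrite /derivable /derive /= /comp /= => h2 h3.
by split; rewrite /derivable /derive /= -E.
Qed.

Lemma derive_lnf F x v dF : 0 < F x -> is_derive x v F dF ->
  is_derive x v (fun y => ln (F y)) ((F x)^-1 * dF).
Proof. by move=> F0 hF; apply: derive_comp1 hF _; exact: is_derive1_ln. Qed.

End directional.

(** * Mean value theorem along a line, and symmetry of mixed derivatives *)

Section mean_value.
Context {R : realType} {V : normedModType R}.
Implicit Types (F : V -> R) (U : set V) (x v w : V).

(** The segment is rescaled to the unit interval, so that [a] may have either sign or vanish. *)
Lemma MVT_line F x v (a : R) :
  (forall s : R, 0 <= s <= 1 -> derivable F (x + (s * a) *: v) v) ->
  exists2 s : R, 0 < s < 1 &
    F (x + a *: v) - F x = a * 'D_v F (x + (s * a) *: v).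
Proof.
move=> dF.
pose g (s : R) := F (x + (s * a) *: v).
have dg (s : R) : 0 <= s <= 1 ->
    is_derive s 1 g (a * 'D_v F (x + (s * a) *: v)).
  move=> s01; have ds := is_derive_line (dF s s01).
  have dm : is_derive s 1 (fun s : R => s * a) a.
    have := derive_mulf (is_derive_id s (1 : R)) (derive_cstf a s 1).
    by rewrite mul1r mulr0 addr0.
  apply: is_derive_eq.
    exact: (@is_derive1_comp _ (fun s => F (x + s *: v)) (fun s => s * a)).
  by rewrite mulrC.
have cg : {within `[0, 1], continuous g}.
  apply: derivable_within_continuous => s; rewrite in_itv /= => /dg ds.
  by case: ds.
have h01 (s : R) : s \in `]0, 1[ -> 0 <= s <= 1.
  by rewrite in_itv /= => /andP[/ltW -> /ltW ->].
have [s s01 E] := MVT (@ltr01 R) (fun s h => dg s (h01 s h)) cg.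
exists s; first by move: s01; rewrite in_itv.
by move: E; rewrite /g mul1r mul0r scale0r addr0 subr0 mulr1.
Qed.


Lemma schwarz_derive U F x v w : open U -> U x ->
  (forall y, U y -> derivable F y v) -> (forall y, U y -> derivable F y w) ->
  (forall y, U y -> derivable ('D_v F) y w) ->
  (forall y, U y -> derivable ('D_w F) y v) ->
  {for x, continuous ('D_w ('D_v F))} -> {for x, continuous ('D_v ('D_w F))} ->
  'D_w ('D_v F) x = 'D_v ('D_w F) x.
Proof.
move=> oU Ux dv dw dvw dwv cvw cwv.
have second_diff (v' w' : V) (e : R) : 0 < e ->
    (forall y, U y -> derivable F y v') ->
    (forall y, U y -> derivable ('D_v' F) y w') ->
    {for x, continuous ('D_w' ('D_v' F))} ->
    \forall h \near (0 : R), 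
      `|F (x + h *: v' + h *: w') - F (x + h *: v') - (F (x + h *: w') - F x)
        - h * h * 'D_w' ('D_v' F) x| <= e * (h * h).
  move=> e0 dF ddF cF.
  have : \forall y \near x, U y /\ `|'D_w' ('D_v' F) x - 'D_w' ('D_v' F) y| < e.
    near=> y; split; near: y; first exact: open_nbhs_nbhs.
    by move/cvgrPdist_lt : cF => /(_ e e0).
  move=> /nbhs_ballP[r /= r0 rU].
  (* The summand 1 keeps the denominator positive when both directions are zero; the whole
     parallelogram with sides [h *: v'] and [h *: w'] then stays in the ball. *)
  have r1 : 0 < r / (`|v'| + `|w'| + 1).
    by rewrite divr_gt0// ltr_pwDr// addr_ge0.
  near=> h.
  have hr : `|h| < r / (`|v'| + `|w'| + 1).
    near: h; apply/nbhs_ballP; exists (r / (`|v'| + `|w'| + 1)) => //= z.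
    by rewrite /ball/= sub0r normrN.
  have inball (a b : R) : 0 <= a <= 1 -> 0 <= b <= 1 ->
      ball x r (x + (a * h) *: v' + (b * h) *: w').
    move=> /andP[a0 a1] /andP[b0 b1]; rewrite -ball_normE /=.
    rewrite -addrA opprD addNKr normrN.
    apply: le_lt_trans (ler_normD _ _) _; rewrite !normrZ ?normrM.
    rewrite (ger0_norm a0) (ger0_norm b0).
    move: hr; rewrite ltr_pdivlMr ?ltr_pwDr ?addr_ge0//.
    apply: le_lt_trans; rewrite mulrDr mulrDr mulr1.
    rewrite -[leLHS]addr0; apply: lerD => //; apply: lerD.
      by rewrite -mulrA ler_piMl// mulr_ge0.
    by rewrite -mulrA ler_piMl// mulr_ge0.
  (* The second difference is the increment of [G] along [v']. The mean value theorem for [G] along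
     [v'], followed by the one for ['D_v' F] along [w'], turns it into [h * h] times a mixed
     derivative at a nearby point. *)
  pose G y := F (y + h *: w') - F y.
  have dG (s : R) : 0 <= s <= 1 -> is_derive (x + (s * h) *: v') v' G
      ('D_v' F (x + (s * h) *: v' + h *: w') - 'D_v' F (x + (s * h) *: v')).
    move=> s01; apply: derive_addf; last apply: derive_oppf.
      apply: is_derive_translate; apply: dF.
      have := rU _ (inball s 1 s01 _); rewrite mul1r ler01 lexx.
      by move=> /(_ isT)[].
    apply: derivableP; apply: dF.
    have := rU _ (inball s 0 s01 _); rewrite mul0r scale0r addr0 lexx ler01.
    by move=> /(_ isT)[].
  have dG' (s : R) : 0 <= s <= 1 -> derivable G (x + (s * h) *: v') v'.
    by move=> /dG[].
  have ddF' (a s : R) : 0 <= a <= 1 -> 0 <= s <= 1 ->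
      derivable ('D_v' F) (x + (a * h) *: v' + (s * h) *: w') w'.
    by move=> a01 s01; apply: ddF; have [] := rU _ (inball a s a01 s01).
  have [a a01' Ea] := MVT_line dG'.
  have a01 : 0 <= a <= 1 by case/andP: a01' => /ltW -> /ltW ->.
  have [b b01' Eb] := MVT_line (fun s => @ddF' a s a01).
  have b01 : 0 <= b <= 1 by case/andP: b01' => /ltW -> /ltW ->.
  have /ltW := (rU _ (inball a b a01 b01)).2.
  move: Ea; have [_ ->] := dG a a01; rewrite Eb /G.
  move=> -> ler_e.
  have hh : 0 <= h * h by rewrite -expr2 sqr_ge0.
  move: ler_e; set d1 := 'D_w' ('D_v' F) x; set d2 := 'D_w' ('D_v' F) (_ + _).
  have -> : h * (h * d2) - h * h * d1 = - (h * h * (d1 - d2)) by ring.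
  by rewrite normrN normrM (ger0_norm hh) mulrC; exact: ler_wpM2r.
(* The second difference is symmetric in [v] and [w], so both mixed derivatives approximate it for
   the same [h]; hence they differ by at most [e], for every positive [e]. *)
apply/eqP; rewrite -subr_eq0 -normr_eq0; apply/eqP/le_anti.
rewrite normr_ge0 andbT; apply/ler_addgt0Pr => e e0; rewrite add0r.
have e2 : 0 < e / 2 by rewrite divr_gt0.
have h1 := second_diff v w (e / 2) e2 dv dvw cvw.
have h2 := second_diff w v (e / 2) e2 dw dwv cwv.
near (0 : R)^'+ => h.
have h0 : 0 < h by near: h; exact: nbhs_right_gt.
have hh0 : 0 < h * h by rewrite mulr_gt0.
rewrite -(ler_pM2r hh0) -[X in _ * X <= _](gtr0_norm hh0) -normrM.
have [k1 k2] : `|F (x + h *: v + h *: w) - F (x + h *: v) - (F (x + h *: w) - F x)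
      - h * h * 'D_w ('D_v F) x| <= e / 2 * (h * h) /\
    `|F (x + h *: w + h *: v) - F (x + h *: w) - (F (x + h *: v) - F x)
      - h * h * 'D_v ('D_w F) x| <= e / 2 * (h * h).
  by near: h; apply: cvg_within; exact: filterI h1 h2.
move: k1 k2; rewrite [x + h *: w + _]addrAC.
set p := F (_ + _ + _); set a := F (x + h *: v); set b := F (x + h *: w).
set A := 'D_w _ x; set B := 'D_v _ x => k1 k2.
have -> : (A - B) * (h * h) = (p - b - (a - F x) - h * h * B)
                            - (p - a - (b - F x) - h * h * A) by ring.
rewrite (splitr e) mulrDl; apply: le_trans (ler_normB _ _) _.
exact: (lerD k2 k1).
Unshelve. all: by end_near.
Qed.

End mean_value.

(** * Differentiability and the chain rule from partial derivatives *)

Section coordinates.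
Context {R : realType} {n : nat}.
Implicit Types (u : 'rV[R]_n -> R) (x w : 'rV[R]_n).

Lemma differentiable_partials (U : set 'rV[R]_n) u x : open U -> U x ->
  (forall c y, U y -> derivable u y (delta_mx 0 c)) ->
  (forall c, {for x, continuous ('D_(delta_mx 0 c) u)}) ->
  differentiable u x.
Proof.
move=> oU Ux du cu.
pose a c := 'D_(delta_mx 0 c) u x.
pose L (w : 'rV[R]_n) : R := \sum_c w 0 c * a c.
have Llin : linear L.
  move=> k v w; rewrite /L scaler_sumr -big_split; apply: eq_bigr => c _ /=.
  by rewrite !mxE mulrDl -mulrA.
pose LM := GRing.isLinear.Build _ _ _ _ L Llin.
pose LL : {linear 'rV[R]_n -> R} := HB.pack L LM.
have cL : continuous LL.
  apply: continuous_big => [|c _ w]; first exact: add_continuous.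
  apply: (@continuousM _ _ (fun w : 'rV[R]_n => w 0 c) (cst (a c))).
    exact: coord_continuous.
  exact: cst_continuous.
have H (e : R) : 0 < e -> \forall w \near (0 : 'rV[R]_n),
    `|u (w + x) - (u x + L w)| <= e * `|w|.
  (* Each of the [n] coordinate steps below costs this much times the norm of [w]; [n.+1] instead of
     [n] avoids a zero denominator when [n = 0]. *)
  move=> e0; have e1 : 0 < e / n.+1%:R by rewrite divr_gt0.
  have : \forall y \near x, U y /\ forall c, `|a c - 'D_(delta_mx 0 c) u y| <= e / n.+1%:R.
    near=> y; split; near: y; first exact: open_nbhs_nbhs.
    apply: filter_forall => c.
    by move/cvgrPdist_le : (cu c) => /(_ _ e1).
  move=> /nbhs_ballP[r /= r0 rU].
  near=> w.
  have wr : `|w| < r.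
    near: w; apply/nbhs_ballP; exists r => //= z.
    by rewrite -ball_normE /= sub0r normrN.
  (* [p] is a polygonal path from 0 to [w] that changes one coordinate at a time, so each step is
     governed by a single partial derivative and the increments telescope. *)
  pose p (k : nat) : 'rV[R]_n := \row_i (if (i < k)%N then w 0 i else 0).
  have pS (k : 'I_n) : p k.+1 = p k + w 0 k *: delta_mx 0 k.
    apply/rowP => i; rewrite !mxE ltnS leq_eqVlt /=.
    have [->|ik] := eqVneq i k; first by rewrite eqxx ltnn /= add0r mulr1.
    by rewrite (inj_eq val_inj) (negbTE ik) /= mulr0 addr0.
  have p0 : p 0%N = 0 by apply/rowP => i; rewrite !mxE.
  have pn : p n = w by apply/rowP => i; rewrite !mxE ltn_ord.
  have inU (k : 'I_n) (s : R) : 0 <= s <= 1 ->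
      ball x r (x + p k + (s * w 0 k) *: delta_mx 0 k).
    move=> /andP[s0 s1]; rewrite -ball_normE /= -addrA opprD addNKr normrN.
    apply: le_lt_trans wr.
    rewrite [in leLHS]/Num.Def.normr /= mx_normrE.
    apply: bigmax_le => // -[i j] _ /=; rewrite !mxE ord1 eqxx /=.
    have wj : `|w 0 j| <= `|w|.
      rewrite [in leRHS]/Num.Def.normr /= mx_normrE.
      exact: (le_bigmax _ (fun ij => `|w ij.1 ij.2|) (0, j)).
    move: wj; have [->|jk wj] := eqVneq j k.
      move=> wk; rewrite ltnn add0r mulr1 normrM ger0_norm//.
      by apply: le_trans wk; rewrite ler_piMl.
    by rewrite mulr0 addr0; case: ifP => // _; rewrite normr0.
  have E (k : 'I_n) : `|u (x + p k.+1) - u (x + p k) - w 0 k * a k| <= e / n.+1%:R * `|w|.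
    rewrite pS addrA.
    have dk (s : R) : 0 <= s <= 1 ->
       derivable u (x + p k + (s * w 0 k) *: delta_mx 0 k) (delta_mx 0 k).
      by move=> s01; apply: du; have [] := rU _ (inU k s s01).
    have [s /andP[/ltW s0 /ltW s1] ->] := MVT_line dk.
    have s01 : 0 <= s <= 1 by rewrite s0.
    rewrite -mulrBr normrM mulrC; apply: ler_pM => //.
      by rewrite distrC; have [_] := rU _ (inU k s s01); exact.
    rewrite [in leRHS]/Num.Def.normr /= mx_normrE.
    exact: (le_bigmax _ (fun ij => `|w ij.1 ij.2|) (0, k)).
  have -> : u (w + x) - (u x + L w) =
     \sum_(k < n) (u (x + p k.+1) - u (x + p k) - w 0 k * a k).
    rewrite sumrB -(big_mkord xpredT (fun k => u (x + p k.+1) - u (x + p k))).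
    rewrite telescope_sumr// p0 pn addr0.
    by rewrite opprD addrA [w + x]addrC.
  apply: le_trans (ler_norm_sum _ _ _) _.
  apply: le_trans (ler_sum _ (fun k _ => E k)) _.
  rewrite sumr_const card_ord -[id w]/w -mulrnAl ler_wpM2r// -mulr_natr.
  rewrite mulrAC ler_pdivrMr//; apply: ler_wpM2l; first exact: ltW.
  by rewrite ler_nat.
have dE : 'd u x = LL :> (_ -> _).
  by apply: diff_unique => //; apply/eqaddoP.
by apply/diff_locallyP; rewrite dE; split => //; apply/eqaddoP.
Unshelve. all: by end_near.
Qed.


Lemma derive_coordE u x v : differentiable u x ->
  'D_v u x = \sum_c v 0 c * 'D_(delta_mx 0 c) u x.
Proof.
move=> du; rewrite deriveE// {1}(row_sum_delta v) linear_sum.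
by apply: eq_bigr => c _; rewrite linearZ deriveE.
Qed.

Lemma differentiable_rV (V : normedModType R) (phi : V -> 'rV[R]_n) (x : V) :
  (forall c, differentiable (fun y => phi y 0 c) x) -> differentiable phi x.
Proof.
move=> dphi.
have -> : phi = \sum_c (fun y => phi y 0 c *: (delta_mx 0 c : 'rV[R]_n)).
  by apply/funext => y; rewrite fct_sumE [LHS]row_sum_delta.
by apply: differentiable_sum => c; exact: differentiableZl.
Qed.

Lemma derive_comp_rV (V : normedModType R) (phi : V -> 'rV[R]_n) u (x v : V) :
  differentiable phi x -> differentiable u (phi x) ->
  is_derive x v (fun y => u (phi y))
    (\sum_c 'D_v phi x 0 c * 'D_(delta_mx 0 c) u (phi x)).
Proof.
move=> dphi du; have dup := differentiable_comp dphi du.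
split; first exact: diff_derivable.
rewrite deriveE// diff_comp//= -derive_coordE// [RHS]deriveE//.
by rewrite deriveE.
Qed.

End coordinates.

(** * Smooth functions *)

Section smooth_calculus.
Context {R : realType} {V : normedModType R}.

Lemma near_open (U : set V) (x : V) (P : V -> Prop) : open U -> U x ->
  (forall y, U y -> P y) -> \forall y \near x, P y.
Proof. by move=> oU Ux UP; apply: filterS UP _; exact: open_nbhs_nbhs. Qed.

Lemma continuous_near_eq (W : topologicalType) (F G : V -> W) (x : V) :
  (\forall y \near x, F y = G y) -> {for x, continuous F} ->
  {for x, continuous G}.
Proof.
move=> FG cF; have /= FGx := nbhs_singleton FG.
rewrite /prop_for /continuous_at -FGx.
by apply: cvg_trans cF; exact: near_eq_cvg.
Qed.

(** A coinduction principle: a class of continuous, derivable functions that is stable under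
    directional derivatives contains only smooth functions. Stability is required only up to
    equality on [U], which suffices because derivatives at points of an open set are local. *)
Lemma smooth_coind (W : normedModType R) (U : set V) (P : (V -> W) -> Prop) :
  open U ->
  (forall F x, P F -> U x ->
     {for x, continuous F} /\ forall v, derivable F x v) ->
  (forall F v, P F -> exists2 G, P G & forall x, U x -> 'D_v F x = G x) ->
  forall F, P F -> smooth_open U F.
Proof.
move=> oU P1 PD F PF vs x Ux.
have [G PG FG] : exists2 G, P G & forall y, U y -> iter_derive vs F y = G y.
  elim: vs => [|v vs [G PG FG]]; first by exists F.
  have [H PH GH] := PD G v PG; exists H => // y Uy.
  by rewrite -GH//=; apply: near_eq_derive; exact: near_open FG.
have [cG dG] := P1 G x PG Ux.
have GF : \forall y \near x, G y = iter_derive vs F y.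
  by apply: near_open oU Ux _ => y /FG ->.
split; last exact: continuous_near_eq GF cG.
by move=> v; exact: near_eq_derivable GF (dG v).
Qed.

Section open_set.
Context {W : normedModType R}.
Implicit Types (U : set V) (F G : V -> W).

Lemma smooth_continuous U F x : smooth_open U F -> U x ->
  {for x, continuous F}.
Proof. by move=> sF Ux; have [] := sF [::] x Ux. Qed.

Lemma smooth_derivable U F x v : smooth_open U F -> U x -> derivable F x v.
Proof. by move=> sF Ux; have [] := sF [::] x Ux. Qed.

Lemma smooth_is_derive U F x v : smooth_open U F -> U x ->
  is_derive x v F ('D_v F x).
Proof. by move=> sF Ux; apply: derivableP; exact: smooth_derivable sF Ux. Qed.

Lemma smooth_derive U F v : smooth_open U F -> smooth_open U ('D_v F).
Proof.
move=> sF vs x Ux; have := sF (rcons vs v) x Ux.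
by rewrite /iter_derive foldr_rcons.
Qed.

Lemma smooth_eq U F G : open U -> (forall x, U x -> F x = G x) ->
  smooth_open U F -> smooth_open U G.
Proof.
move=> oU FG sF; pose P (H : V -> W) := exists2 K, smooth_open U K & forall x, U x -> K x = H x.
apply: (@smooth_coind _ _ P) => //; last by exists F.
- move=> H x [K sK KH] Ux; have KHx := near_open oU Ux KH; split.
    exact: continuous_near_eq KHx (smooth_continuous sK Ux).
  by move=> v; exact: near_eq_derivable KHx (smooth_derivable sK Ux).
- move=> H v [K sK KH]; exists ('D_v K).
    by exists ('D_v K) => //; exact: smooth_derive.
  by move=> x Ux; apply: near_eq_derive; apply: near_open oU Ux _ => y /KH.
Qed.

Lemma smooth_sub U U' F : U `<=` U' -> smooth_open U' F -> smooth_open U F.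
Proof. by move=> UU' sF vs x /UU'; exact: sF. Qed.

Lemma smooth_local U F :
  (forall x, U x -> exists2 U', open U' /\ U' x & smooth_open U' F) ->
  smooth_open U F.
Proof. by move=> H vs x Ux; have [U' [_ U'x] sF] := H x Ux; exact: sF. Qed.

End open_set.

Section algebra.
Variable U : set V.
Hypothesis oU : open U.
Implicit Types F G : V -> R.

(** The invariant class for [smooth_coind]. The derivative of a product, inverse or logarithm is an
    expression mixing several of these operations, so closure under differentiation can only be
    proved for all of them together. *)
Inductive elementary : (V -> R) -> Prop :=
| elementary_smooth F of smooth_open U F : elementary F
| elementary_cst c : elementary (fun=> c)
| elementary_add F G of elementary F & elementary G :
    elementary (fun x => F x + G x)
| elementary_opp F of elementary F : elementary (fun x => - F x)
| elementary_mul F G of elementary F & elementary G :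
    elementary (fun x => F x * G x)
| elementary_inv F of elementary F & (forall x, U x -> F x != 0) :
    elementary (fun x => (F x)^-1)
| elementary_ln F of elementary F & (forall x, U x -> 0 < F x) :
    elementary (fun x => ln (F x)).

Lemma elementary_spec F : elementary F ->
  (forall x, U x -> {for x, continuous F} /\ forall v, derivable F x v) /\
  (forall v, exists2 G, elementary G & forall x, U x -> 'D_v F x = G x).
Proof.
elim=> {F}.
- move=> F sF; split=> [x Ux|v].
    by split=> [|v]; [exact: smooth_continuous sF Ux|exact: smooth_derivable sF Ux].
  by exists ('D_v F) => //; apply: elementary_smooth; exact: smooth_derive.
- move=> c; split=> [x Ux|v].
    by split=> [|v]; [exact: cst_continuous|exact: derivable_cst].
  by exists (fun=> 0) => [|x _]; [exact: elementary_cst|exact: derive_cst].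
- move=> F G eF [F1 FD] eG [G1 GD]; split=> [x Ux|v].
    have [[cF dF] [cG dG]] := (F1 x Ux, G1 x Ux).
    by split=> [|v]; [exact: cvgD|exact: derivableD].
  have [[F' eF' FF'] [G' eG' GG']] := (FD v, GD v).
  exists (fun x => F' x + G' x) => [|x Ux]; first exact: elementary_add.
  rewrite -FF'// -GG'//.
  by apply: (@derive_val _ _ _ _ _ _ _ (derive_addf (derivableP ((F1 x Ux).2 v)) (derivableP ((G1 x Ux).2 v)))).
- move=> F eF [F1 FD]; split=> [x Ux|v].
    have [cF dF] := F1 x Ux.
    by split=> [|v]; [exact: cvgN|exact: derivableN].
  have [F' eF' FF'] := FD v.
  exists (fun x => - F' x) => [|x Ux]; first exact: elementary_opp.
  by rewrite -FF'//; have [] := derive_oppf (derivableP ((F1 x Ux).2 v)).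
- move=> F G eF [F1 FD] eG [G1 GD]; split=> [x Ux|v].
    have [[cF dF] [cG dG]] := (F1 x Ux, G1 x Ux).
    by split=> [|v]; [exact: cvgM|exact: derivableM].
  have [[F' eF' FF'] [G' eG' GG']] := (FD v, GD v).
  exists (fun x => F' x * G x + F x * G' x) => [|x Ux].
    by apply: elementary_add; exact: elementary_mul.
  rewrite -FF'// -GG'//.
  by have [] := derive_mulf (derivableP ((F1 x Ux).2 v)) (derivableP ((G1 x Ux).2 v)).
- move=> F eF [F1 FD] F0; split=> [x Ux|v].
    have [cF dF] := F1 x Ux.
    by split=> [|v]; [exact: cvgV (F0 x Ux) cF|exact: derivableV (F0 x Ux) (dF v)].
  have [F' eF' FF'] := FD v.
  have eV : elementary (fun x => (F x)^-1) by exact: elementary_inv.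
  exists (fun x => - ((F x)^-1 * (F x)^-1 * F' x)) => [|x Ux].
    by apply: elementary_opp; apply: elementary_mul => //; exact: elementary_mul.
  by rewrite -FF'//; have [] := derive_invf (F0 x Ux) (derivableP ((F1 x Ux).2 v)).
- move=> F eF [F1 FD] F0; split=> [x Ux|v].
    have [cF dF] := F1 x Ux; split=> [|v].
      by apply: continuous_comp => //; exact: continuous_ln (F0 x Ux).
    by have [] := derive_lnf (F0 x Ux) (derivableP (dF v)).
  have [F' eF' FF'] := FD v.
  exists (fun x => (F x)^-1 * F' x) => [|x Ux].
    by apply: elementary_mul => //; apply: elementary_inv => // x Ux; rewrite gt_eqF// F0.
  by rewrite -FF'//; have [] := derive_lnf (F0 x Ux) (derivableP ((F1 x Ux).2 v)).
Qed.

Lemma smooth_elementary F : elementary F -> smooth_open U F.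
Proof.
apply: smooth_coind => // [G x /elementary_spec[+ _]|G v /elementary_spec[_]];
  exact.
Qed.

Lemma smooth_cst (c : R) : smooth_open U (fun=> c).
Proof. exact/smooth_elementary/elementary_cst. Qed.

Lemma smooth_add F G : smooth_open U F -> smooth_open U G ->
  smooth_open U (fun x => F x + G x).
Proof.
by move=> sF sG; apply/smooth_elementary/elementary_add; exact: elementary_smooth.
Qed.

Lemma smooth_opp F : smooth_open U F -> smooth_open U (fun x => - F x).
Proof.
by move=> sF; apply/smooth_elementary/elementary_opp; exact: elementary_smooth.
Qed.

Lemma smooth_mul F G : smooth_open U F -> smooth_open U G ->
  smooth_open U (fun x => F x * G x).
Proof.
by move=> sF sG; apply/smooth_elementary/elementary_mul; exact: elementary_smooth.
Qed.

Lemma smooth_inv F : (forall x, U x -> F x != 0) -> smooth_open U F ->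
  smooth_open U (fun x => (F x)^-1).
Proof.
by move=> F0 sF; apply/smooth_elementary/elementary_inv => //; exact: elementary_smooth.
Qed.

Lemma smooth_ln F : (forall x, U x -> 0 < F x) -> smooth_open U F ->
  smooth_open U (fun x => ln (F x)).
Proof.
by move=> F0 sF; apply/smooth_elementary/elementary_ln => //; exact: elementary_smooth.
Qed.

Lemma smooth_schwarz F v w x : smooth_open U F -> U x ->
  'D_w ('D_v F) x = 'D_v ('D_w F) x.
Proof.
move=> sF Ux; have sv := smooth_derive v sF; have sw := smooth_derive w sF.
apply: (schwarz_derive oU Ux) => [y Uy|y Uy|y Uy|y Uy||].
- exact: smooth_derivable sF Uy.
- exact: smooth_derivable sF Uy.
- exact: smooth_derivable sv Uy.
- exact: smooth_derivable sw Uy.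
- exact: smooth_continuous (smooth_derive w sv) Ux.
- exact: smooth_continuous (smooth_derive v sw) Ux.
Qed.

Lemma derive_coef m n (M : V -> 'M[R]_(m, n)) i j x v : smooth_open U M -> U x ->
  'D_v (fun y => M y i j) x = 'D_v M x i j.
Proof.
by move=> sM Ux; rewrite derive_mx ?mxE//; exact: smooth_derivable sM Ux.
Qed.

Lemma smooth_coef m n (M : V -> 'M[R]_(m, n)) i j : smooth_open U M ->
  smooth_open U (fun y => M y i j).
Proof.
move=> sM.
pose P (F : V -> R) := exists2 M : V -> 'M[R]_(m, n), smooth_open U M &
  F = fun y => M y i j.
apply: (@smooth_coind _ _ P) => //; last by exists M.
- move=> F x [{}M {}sM ->] Ux; split.
    apply: (@continuous_comp _ _ _ M (fun N : 'M[R]_(m, n) => N i j)).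
      exact: smooth_continuous sM Ux.
    exact: coord_continuous.
  by move=> v; apply: (derivable_mxP M x v).1; exact: smooth_derivable sM Ux.
- move=> F v [{}M {}sM ->]; exists (fun y => 'D_v M y i j).
    by exists ('D_v M); first exact: smooth_derive.
  by move=> x Ux; exact: derive_coef.
Qed.

End algebra.


End smooth_calculus.

Lemma smooth_differentiable (R : realType) n (U : set 'rV[R]_n) (u : 'rV[R]_n -> R) x :
  open U -> smooth_open U u -> U x -> differentiable u x.
Proof.
move=> oU su Ux; apply: (differentiable_partials oU Ux).
  by move=> c y Uy; exact: smooth_derivable su Uy.
by move=> c; exact: smooth_continuous (smooth_derive _ su) Ux.
Qed.

(** * Slices of functions on a product with the time line *)

Section slices.
Context {R : realType} {V : normedModType R}.
Implicit Types (F : V * R -> R).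

Lemma derive_slicel F v x (t : R) :
  'D_v (fun y => F (y, t)) x = 'D_(v, 0) F (x, t).
Proof.
rewrite /derive; set d := (fun h : R => _); set d' := (fun h : R => _).
suff -> : d = d' by []; apply/funext => h; rewrite /d /d' /=.
have -> : h *: (v, 0) + (x, t) = (h *: v + x, h * 0 + t) :> V * R by [].
by rewrite mulr0 add0r.
Qed.

Lemma derive_slicer F x (t : R) :
  'D_1 (fun s => F (x, s)) t = 'D_(0, 1) F (x, t).
Proof.
rewrite /derive; set d := (fun h : R => _); set d' := (fun h : R => _).
suff -> : d = d' by []; apply/funext => h; rewrite /d /d' /=.
have -> : h *: (0, 1) + (x, t) = (h *: 0 + x, h *: 1 + t) :> V * R by [].
by rewrite scaler0 add0r.
Qed.

Lemma smooth_slice (U : set (V * R)) F (t : R) : open U -> smooth_open U F ->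
  smooth_open [set x | U (x, t)] (fun x => F (x, t)).
Proof.
move=> oU sF.
have oUt : open [set x | U (x, t)].
  apply: (@open_comp _ _ (fun x : V => (x, t)) U) => // x _.
  exact: (cvg_pair (@cvg_id _ (nbhs x)) (cvg_cst t)).
pose P (G : V -> R) := exists2 H : V * R -> R, smooth_open U H &
  G = fun x => H (x, t).
apply: (@smooth_coind _ _ _ _ P) => //; last by exists F.
- move=> G x [H sH ->] Ux; split.
    apply: (@continuous_comp _ _ _ (fun x : V => (x, t)) H).
      exact: (cvg_pair (@cvg_id _ (nbhs x)) (cvg_cst t)).
    exact: smooth_continuous sH Ux.
  move=> v; have := smooth_derivable (v := (v, 0)) sH Ux.
  rewrite /derivable; set d := (fun h : R => _); set d' := (fun h : R => _).
  suff -> : d = d' by []; apply/funext => h; rewrite /d /d' /=.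
  have -> : h *: (v, 0) + (x, t) = (h *: v + x, h * 0 + t) :> V * R by [].
  by rewrite mulr0 add0r.
- move=> G v [H sH ->]; exists (fun x => 'D_(v, 0) H (x, t)).
    by exists ('D_(v, 0) H); first exact: smooth_derive.
  by move=> x Ux; exact: derive_slicel.
Qed.

(** Lets time-independent coefficients, such as the metric and the Christoffel symbols, be treated
    as smooth functions on space-time. *)
Lemma smooth_fst (U : set V) (G : V -> R) : open U -> smooth_open U G ->
  smooth_open (U `*` [set: R]) (fun z => G z.1).
Proof.
move=> oU sG.
have oUT : open (U `*` [set: R]).
  rewrite [X in open X](_ : _ = fst @^-1` U); last first.
    by apply/seteqP; split=> [z []|z ?].
  by apply: open_comp => // z _; exact: cvg_fst.
pose P (F : V * R -> R) := exists2 H : V -> R, smooth_open U H &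
  F = fun z => H z.1.
apply: (@smooth_coind _ _ _ _ P) => //; last by exists G.
- move=> F z [H sH ->] [Uz _]; split.
    apply: (@continuous_comp _ _ _ (@fst V R) H); first exact: cvg_fst.
    exact: smooth_continuous sH Uz.
  move=> v; have := smooth_derivable (v := v.1) sH Uz.
  by [].
- move=> F v [H sH ->]; exists (fun z => 'D_(v.1) H z.1).
    by exists ('D_(v.1) H); first exact: smooth_derive.
  by [].
Qed.

End slices.

(** * Bochner's formula in dimension 2 *)

Section partials.
Context {R : realType} {n : nat}.
Implicit Types (u : 'rV[R]_n -> R) (x : 'rV[R]_n) (U : set 'rV[R]_n).

Lemma smooth_partial U u a : smooth_open U u -> smooth_open U (partial a u).
Proof. exact: smooth_derive. Qed.

Lemma smooth_is_partial U u a x : smooth_open U u -> U x ->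
  is_derive x (delta_mx 0 a) u (partial a u x).
Proof. exact: smooth_is_derive. Qed.

Lemma partial_val u a x d e : is_derive x (delta_mx 0 a) u d -> d = e ->
  partial a u x = e.
Proof. by rewrite /partial => -[_ ->]. Qed.

Lemma partial_eq U u w a x : open U -> U x -> (forall y, U y -> u y = w y) ->
  partial a u x = partial a w x.
Proof. by move=> oU Ux uw; apply: near_eq_derive; exact: near_open uw. Qed.

Lemma partialC U u a b x : open U -> smooth_open U u -> U x ->
  partial a (partial b u) x = partial b (partial a u) x.
Proof. by move=> oU su Ux; exact: smooth_schwarz su Ux. Qed.

End partials.

Lemma sum2E (V : nmodType) (F : 'I_2 -> V) : \sum_i F i = F 0 + F 1.
Proof.
rewrite !big_ord_recl big_ord0 addr0; congr (_ + F _).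
exact: val_inj.
Qed.

Ltac smooth_step :=
  lazymatch goal with
  | |- smooth_open _ (fun y => _ + _) => apply: smooth_add
  | |- smooth_open _ (fun y => - _) => apply: smooth_opp
  | |- smooth_open _ (fun y => _ * _) => apply: smooth_mul
  | |- smooth_open _ (fun y => @GRing.inv _ _) => apply: smooth_inv
  | |- smooth_open _ (fun y => ln _) => apply: smooth_ln
  | |- smooth_open _ (fun=> _) => apply: smooth_cst
  | |- smooth_open ?U (fun y => ?f y) => change (smooth_open U f)
  | |- smooth_open _ (partial _ _) => apply: smooth_partial
  | H : smooth_open ?U ?f |- smooth_open ?U ?f => exact: H
  | H : forall i, smooth_open ?U (?f i) |- smooth_open ?U (?f _) => exact: H
  | H : forall i j, smooth_open ?U (?f i j) |- smooth_open ?U (?f _ _) =>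
      exact: H
  | H : forall i j k, smooth_open ?U (?f i j k) |- smooth_open ?U (?f _ _ _) =>
      exact: H
  | |- open _ => assumption
  end.

Ltac smooth_tac := repeat smooth_step.

(** Differentiates by following the shape of the expression. At a leaf, a derivative available as a
    hypothesis takes precedence over smoothness; this is how reciprocals and functions composed with
    a chart change are handled as atoms. *)
Ltac partial_step :=
  lazymatch goal with
  | |- is_derive _ _ (fun y => _ + _) _ =>
      notypeclasses refine (derive_addf _ _)
  | |- is_derive _ _ (fun y => - _) _ => notypeclasses refine (derive_oppf _)
  | |- is_derive _ _ (fun y => _ * _) _ =>
      notypeclasses refine (derive_mulf _ _)
  | |- is_derive _ _ (fun=> _) _ => notypeclasses refine (derive_cstf _ _ _)
  | D : is_derive ?x ?v ?f _ |- is_derive ?x ?v (fun y => ?f y) _ => exact: D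
  | D : is_derive ?x ?v ?f _ |- is_derive ?x ?v ?f _ => exact: D
  | Ux : ?U ?x |- is_derive ?x _ (fun y => ?f y) _ =>
      notypeclasses refine (@smooth_is_partial _ _ U f _ x _ Ux)
  | Ux : ?U ?x |- is_derive ?x _ ?f _ =>
      notypeclasses refine (@smooth_is_partial _ _ U f _ x _ Ux)
  end.

Ltac partial_tac :=
  notypeclasses refine (partial_val _ _);
  [repeat partial_step; smooth_tac | cbv beta].

(* Values at [x] are generalized first: [ring] would otherwise compare the
   atoms up to conversion. *)
Ltac abstract_at x :=
  repeat match goal with |- context [?f x] => generalize (f x) end.

Ltac ring_at x := abstract_at x; intros; ring.

Section bochner.
Context {R : realType}.
Variable U : set 'rV[R]_2.
Hypothesis oU : open U.
Variables a b : 'I_2.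
Variables (h : 'I_2 -> 'I_2 -> 'rV[R]_2 -> R)
  (Gam : 'I_2 -> 'I_2 -> 'I_2 -> 'rV[R]_2 -> R).
Hypothesis sh : forall i j, smooth_open U (h i j).
Hypothesis sGam : forall k i j, smooth_open U (Gam k i j).
Hypothesis hC : forall i j x, U x -> h i j x = h j i x.
Hypothesis GamC : forall k i j x, U x -> Gam k i j x = Gam k j i x.
(** [h] stands for the inverse metric, and this says that it is parallel: its covariant derivative
    with respect to [Gam] vanishes. *)
Hypothesis metric_connection : forall k i j x, U x ->
  partial k (h i j) x
    = - (Gam i k a x * h a j x + Gam i k b x * h b j x)
      - (Gam j k a x * h i a x + Gam j k b x * h i b x).

(** The component of [riemann] with first two lower indices [a] and [b], the only pair that matters
    by antisymmetry. *)
Definition curv (l k : 'I_2) x : R :=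
  partial a (Gam l b k) x - partial b (Gam l a k) x
  + (Gam l a a x * Gam a b k x - Gam l b a x * Gam a a k x)
  + (Gam l a b x * Gam b b k x - Gam l b b x * Gam b a k x).

Definition dot2 (v w : 'I_2 -> 'rV[R]_2 -> R) x : R :=
  h a a x * v a x * w a x + h a b x * v a x * w b x
  + (h b a x * v b x * w a x + h b b x * v b x * w b x).

Definition gradsq (u : 'rV[R]_2 -> R) x : R :=
  dot2 (fun i => partial i u) (fun i => partial i u) x.

Definition hess (u : 'rV[R]_2 -> R) j k x : R :=
  partial j (partial k u) x
  - (Gam a j k x * partial a u x + Gam b j k x * partial b u x).

Definition lap (u : 'rV[R]_2 -> R) x : R :=
  h a a x * hess u a a x + h a b x * hess u a b x
  + (h b a x * hess u b a x + h b b x * hess u b b x).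

(** The commutator of the covariant derivatives along [a] and [b] acts on the parallel tensor [h]
    through the curvature, once in each slot, and must give zero. Concretely, the equality of the
    mixed partials of [h i j] is expanded by [metric_connection]. *)
Lemma curv_antisym i j x : U x ->
  curv i a x * h a j x + curv i b x * h b j x
  + (curv j a x * h i a x + curv j b x * h i b x) = 0.
Proof.
move=> Ux.
have D p q : partial p (partial q (h i j)) x =
  partial p (fun x => - (Gam i q a x * h a j x + Gam i q b x * h b j x)
      - (Gam j q a x * h i a x + Gam j q b x * h i b x)) x.
  by apply: (partial_eq _ oU Ux) => y Uy; rewrite metric_connection.
have /eqP := partialC a b oU (sh i j) Ux.
rewrite !D -subr_eq0 => /eqP.
set lhs := partial a _ x; set rhs := partial b _ x => E.
rewrite -[RHS]oppr0 -E /lhs /rhs => {D E lhs rhs}.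
have -> : partial a (fun x => - (Gam i b a x * h a j x + Gam i b b x * h b j x)
      - (Gam j b a x * h i a x + Gam j b b x * h i b x)) x = 
   - (partial a (Gam i b a) x * h a j x + Gam i b a x * partial a (h a j) x
    + (partial a (Gam i b b) x * h b j x + Gam i b b x * partial a (h b j) x))
   - (partial a (Gam j b a) x * h i a x + Gam j b a x * partial a (h i a) x
    + (partial a (Gam j b b) x * h i b x + Gam j b b x * partial a (h i b) x)).
  by partial_tac.
have -> : partial b (fun x => - (Gam i a a x * h a j x + Gam i a b x * h b j x)
      - (Gam j a a x * h i a x + Gam j a b x * h i b x)) x = 
   - (partial b (Gam i a a) x * h a j x + Gam i a a x * partial b (h a j) x
    + (partial b (Gam i a b) x * h b j x + Gam i a b x * partial b (h b j) x))
   - (partial b (Gam j a a) x * h i a x + Gam j a a x * partial b (h i a) x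
    + (partial b (Gam j a b) x * h i b x + Gam j a b x * partial b (h i b) x)).
  by partial_tac.
rewrite !metric_connection// /curv.
ring_at x.
Qed.

Variable u : 'rV[R]_2 -> R.
Hypothesis su : smooth_open U u.

Lemma smooth_hess j k : smooth_open U (hess u j k).
Proof. by rewrite /hess; smooth_tac. Qed.
Let sH := smooth_hess.

Lemma hessC j k x : U x -> hess u j k x = hess u k j x.
Proof.
move=> Ux; rewrite /hess (partialC _ _ oU su Ux).
by rewrite !(GamC _ j k Ux).
Qed.

Lemma partial2_hess j k x : partial j (partial k u) x =
  hess u j k x + (Gam a j k x * partial a u x + Gam b j k x * partial b u x).
Proof. by rewrite /hess subrK. Qed.

Lemma partial_gradsq k x : U x -> partial k (gradsq u) x =
  2 * dot2 (fun i => partial i u) (fun j => hess u j k) x.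
Proof.
move=> Ux; rewrite /gradsq /dot2.
partial_tac; rewrite !metric_connection// !partial2_hess.
rewrite !(GamC _ k _ Ux) !(hessC k _ Ux) !(hC b a Ux).
ring_at x.
Qed.

(** The right-hand side is the trace of the covariant derivative of the Hessian, as [h] is parallel.
    The two Christoffel corrections, one for each slot, agree under the trace by symmetry, whence
    the factor 2. *)
Lemma partial_lap k x : U x -> partial k (lap u) x =
  h a a x * (partial k (hess u a a) x
     - 2 * (Gam a k a x * hess u a a x + Gam b k a x * hess u b a x))
  + h a b x * (partial k (hess u a b) x
     - 2 * (Gam a k a x * hess u a b x + Gam b k a x * hess u b b x))
  + (h b a x * (partial k (hess u b a) x
     - 2 * (Gam a k b x * hess u a a x + Gam b k b x * hess u b a x))
  + h b b x * (partial k (hess u b b) x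
     - 2 * (Gam a k b x * hess u a b x + Gam b k b x * hess u b b x))).
Proof.
move=> Ux; rewrite /lap.
partial_tac; rewrite !metric_connection//.
rewrite !(hessC b a Ux) !(hC b a Ux).
ring_at x.
Qed.

(** The third-order term is corrected by Christoffel symbols in the slot [j] only; the correction
    for the slot [k] appears later, from the Hessian of [gradsq] inside [lap]. *)
Lemma partial2_gradsq m k x : U x -> partial m (partial k (gradsq u)) x =
  2 * (dot2 (fun i => hess u i m) (fun j => hess u j k) x
   + dot2 (fun i => partial i u) (fun j => fun x => partial m (hess u j k) x
       - (Gam a m j x * hess u a k x + Gam b m j x * hess u b k x)) x).
Proof.
move=> Ux.
rewrite (partial_eq m oU Ux (partial_gradsq k)) /dot2.
partial_tac; rewrite !metric_connection// !partial2_hess.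
rewrite !(hessC m _ Ux) !(hC b a Ux).
ring_at x.
Qed.

(** The Ricci identity for the covector du: exchanging the two outer covariant derivatives costs a
    curvature term. The corrections in the index pair [a], [b] cancel because [Gam] is symmetric. *)
Lemma codazzi k x : U x ->
  partial a (hess u b k) x = partial b (hess u a k) x
   + (Gam a a k x * hess u a b x + Gam b a k x * hess u b b x)
   - (Gam a b k x * hess u a a x + Gam b b k x * hess u b a x)
   - (curv a k x * partial a u x + curv b k x * partial b u x).
Proof.
move=> Ux.
have E (i j : 'I_2) : partial i (hess u j k) x = partial i (partial j (partial k u)) x
  - (partial i (Gam a j k) x * partial a u x + Gam a j k x * partial i (partial a u) x
  + (partial i (Gam b j k) x * partial b u x + Gam b j k x * partial i (partial b u) x)).
  by rewrite /hess; partial_tac.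
rewrite !E (partialC a b oU (smooth_partial k su) Ux) !partial2_hess /curv.
rewrite !(hessC b a Ux) !(GamC _ b a Ux).
ring_at x.
Qed.

Definition hess_sq x : R :=
  h a a x * dot2 (fun i => hess u i a) (fun i => hess u i a) x
  + h a b x * dot2 (fun i => hess u i a) (fun i => hess u i b) x
  + (h b a x * dot2 (fun i => hess u i b) (fun i => hess u i a) x
  + h b b x * dot2 (fun i => hess u i b) (fun i => hess u i b) x).

(* In dimension 2 the curvature has a single component up to symmetry. *)
Definition gauss x : R := curv a a x * h a b x + curv a b x * h b b x.
End bochner.

Section bochner_formula.
Context {R : realType}.
Variable U : set 'rV[R]_2.
Hypothesis oU : open U.
Variables a b : 'I_2.
Variables (h : 'I_2 -> 'I_2 -> 'rV[R]_2 -> R)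
  (Gam : 'I_2 -> 'I_2 -> 'I_2 -> 'rV[R]_2 -> R).
Hypothesis sh : forall i j, smooth_open U (h i j).
Hypothesis sGam : forall k i j, smooth_open U (Gam k i j).
Hypothesis hC : forall i j x, U x -> h i j x = h j i x.
Hypothesis GamC : forall k i j x, U x -> Gam k i j x = Gam k j i x.
Hypothesis metric_connection : forall k i j x, U x ->
  partial k (h i j) x
    = - (Gam i k a x * h a j x + Gam i k b x * h b j x)
      - (Gam j k a x * h i a x + Gam j k b x * h i b x).
Variable u : 'rV[R]_2 -> R.
Hypothesis su : smooth_open U u.

(** The third derivatives of [u] on the two sides differ only in the order of differentiation, so
    [codazzi] matches them. What is left is linear in the curvature, and [curv_antisym] reduces it
    to the single component [gauss]. *)
Lemma bochner x : U x -> lap a b h Gam (gradsq a b h u) x =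
  2 * dot2 a b h (fun i => partial i u) (fun j => partial j (lap a b h Gam u)) x
  + 2 * hess_sq a b h Gam u x + 2 * gauss a b h Gam x * gradsq a b h u x.
Proof.
move=> Ux.
have P1 := partial_gradsq oU sh hC GamC metric_connection su.
have P2 := partial2_gradsq oU sh sGam hC GamC metric_connection su.
have PL := partial_lap oU sh sGam hC GamC metric_connection su.
have C := codazzi oU a b sGam GamC su.
have CA := curv_antisym oU sh sGam metric_connection.
have HC := hessC oU a b GamC su.
have Hba k : partial k (hess a b Gam u b a) x = partial k (hess a b Gam u a b) x.
  by apply: (partial_eq _ oU Ux) => y Uy; exact: HC.
have E1 := CA a a x Ux.
have E2 := CA b b x Ux.
have E3 := CA a b x Ux.
have lapE w : lap a b h Gam w x =
    h a a x * (partial a (partial a w) x - (Gam a a a x * partial a w x + Gam b a a x * partial b w x))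
  + h a b x * (partial a (partial b w) x - (Gam a a b x * partial a w x + Gam b a b x * partial b w x))
  + (h b a x * (partial b (partial a w) x - (Gam a b a x * partial a w x + Gam b b a x * partial b w x))
  + h b b x * (partial b (partial b w) x - (Gam a b b x * partial a w x + Gam b b b x * partial b w x))).
  by [].
rewrite {}lapE /hess_sq /gauss.
have -> : gradsq a b h u x = h a a x * partial a u x * partial a u x
  + h a b x * partial a u x * partial b u x
  + (h b a x * partial b u x * partial a u x
  + h b b x * partial b u x * partial b u x) by [].
rewrite /dot2 in P1 P2 *.
clear CA sh sGam metric_connection su oU.
move: P1 P2 PL C HC hC GamC Hba E1 E2 E3 Ux.
(* Operators and fields become opaque here, so that what remains is polynomial algebra in their
   values at [x]. *)
move: (gradsq a b h u) (lap a b h Gam u) (hess a b Gam u) (curv a b Gam).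
move: (@partial R 2) => D w Q H K P1 P2 PL C HC hS GS Hba E1 E2 E3 Ux.
rewrite !(P1 _ _ Ux) !(P2 _ _ _ Ux) {P1 P2} !(PL _ _ Ux) {PL}.
rewrite !(GS _ b a x Ux) !(hS b a x Ux) in E1 E2 E3 *.
(* [codazzi] applies to the [a]-derivative of the entry [b k], so the entry [a b] is first replaced
   by [b a] under that derivative. *)
rewrite -!(Hba a) !(C _ _ Ux) !(Hba b) !(HC b a x Ux) !(GS _ b a x Ux).
apply: subr0_eq.
(* The difference of the two sides as an explicit combination of the three relations [E1], [E3] and
   [E2], with coefficients quadratic in du. *)
transitivity (
  - ((h a b x * D a u x + h b b x * D b u x) * D a u x)
   * (K a a x * h a a x + K a b x * h a b x + (K a a x * h a a x + K a b x * h a b x))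
  - 2 * (h a b x * D a u x + h b b x * D b u x) * D b u x
   * (K a a x * h a b x + K a b x * h b b x + (K b a x * h a a x + K b b x * h a b x))
  + (h a a x * D a u x + h a b x * D b u x) * D b u x
   * (K b a x * h a b x + K b b x * h b b x + (K b a x * h a b x + K b b x * h b b x)));
  last by rewrite E1 E2 E3 !mulr0 subrr addr0.
clear; ring_at x.
Qed.

End bochner_formula.

(** * Metrics in coordinates *)

Section quadratic_forms.
Context {R : realType}.
Implicit Types (haa hab hbb p q r : R).

(* [|H|^2 >= (tr H)^2 / 2], where both sides are taken with respect to the
   inverse metric [h]. *)
Lemma trace_sqr_le haa hab hbb p q r :
  0 < haa -> 0 < haa * hbb - hab * hab ->
  (haa * p + hab * q + (hab * q + hbb * r)) ^+ 2 <=
  2 * (haa * (haa * p * p + hab * p * q + (hab * q * p + hbb * q * q))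
    + hab * (haa * p * q + hab * p * r + (hab * q * q + hbb * q * r))
    + (hab * (haa * q * p + hab * q * q + (hab * r * p + hbb * r * q))
    + hbb * (haa * q * q + hab * q * r + (hab * r * q + hbb * r * r)))).
Proof.
move=> h0 D0; rewrite -subr_ge0 -(pmulr_rge0 _ (mulr_gt0 h0 h0)).
set t := (X in 0 <= X).
(* In the [h]-orthonormal frame [e1 = (haa, hab) / sqrt haa], [e2 = (0, sqrt (det h / haa))] the gap
   is [(H11 - H22)^2 + 4 H12^2]; multiplying it by [haa ^+ 2] clears all roots and denominators. *)
have -> : t = (haa * haa * p + 2 * haa * hab * q
               + (2 * hab * hab - haa * hbb) * r) ^+ 2
            + 4 * ((haa * hbb - hab * hab) * (haa * q + hab * r) ^+ 2).
  by rewrite /t; ring.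
by rewrite addr_ge0 ?sqr_ge0// mulr_ge0// mulr_ge0 ?sqr_ge0// ltW.
Qed.

(** [haa] times the trace is the form at [(haa, hab)] plus the determinant of [h] times the form at
    [(0, 1)]; these two vectors are orthogonal for the metric inverse to [h]. *)
Lemma trace_psd_ge0 haa hab hbb p q r :
  0 < haa -> 0 < haa * hbb - hab * hab ->
  (forall c d, 0 <= c * c * p + 2 * c * d * q + d * d * r) ->
  0 <= haa * p + hab * q + (hab * q + hbb * r).
Proof.
move=> h0 D0 H; rewrite -(pmulr_rge0 _ h0).
have -> : haa * (haa * p + hab * q + (hab * q + hbb * r))
  = (haa * haa * p + 2 * haa * hab * q + hab * hab * r)
    + (haa * hbb - hab * hab) * (0 * 0 * p + 2 * 0 * 1 * q + 1 * 1 * r) by ring.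
by rewrite addr_ge0// mulr_ge0// ltW.
Qed.

End quadratic_forms.

Section local_geometry.
Context {R : realType}.
Variables (U : set 'rV[R]_2) (G : 'rV[R]_2 -> 'M[R]_2).
Hypothesis oU : open U.
Hypothesis sG : smooth_open U G.
Hypothesis symG : forall x, U x -> (G x)^T = G x.
Hypothesis posG : forall x, U x -> forall v : 'rV[R]_2, v != 0 ->
  0 < (v *m G x *m v^T) 0 0.
(* The two indices are kept abstract: concrete ordinals make unification slow. *)
Variables a b : 'I_2.
Hypothesis sumab : forall F : 'I_2 -> R, \sum_i F i = F a + F b.
Hypothesis ab : a != b.

Definition metric_ent i j x : R := G x i j.
Local Notation g := metric_ent.
Definition metric_det x := g a a x * g b b x - g a b x * g a b x.
Definition invmetric i j x : R := invmx (G x) i j.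

(** Recovered from [sumab] by summing the indicator function of [i]. *)
Lemma index_cases (i : 'I_2) : i = a \/ i = b.
Proof.
have := sumab (fun j => (j == i)%:R).
rewrite (bigD1 i)//= eqxx big1 ?addr0; last by move=> j /negbTE ->.
have [->|] := eqVneq a i; first by left.
have [->|_ _] := eqVneq b i; first by right.
by rewrite addr0 => /eqP; rewrite oner_eq0.
Qed.

Lemma metricC i j x : U x -> g i j x = g j i x.
Proof. by move=> Ux; rewrite /metric_ent -{1}(symG Ux) mxE. Qed.

Lemma metric_form_gt0 x p q : U x -> (p != 0) || (q != 0) ->
  0 < p * p * g a a x + 2 * p * q * g a b x + q * q * g b b x.
Proof.
move=> Ux pq; pose v : 'rV[R]_2 := \row_i if i == a then p else q.
have va : v 0 a = p by rewrite mxE eqxx.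
have vb : v 0 b = q by rewrite mxE eq_sym (negbTE ab).
have v0 : v != 0.
  apply: contraTneq pq => v0; move: va vb; rewrite v0 !mxE => <- <-.
  by rewrite eqxx.
have := posG Ux v0.
rewrite mxE sumab ![(v *m G x) _ _]mxE !sumab !mxE.
have E i j : G x i j = g i j x by [].
rewrite !E (metricC b a Ux) eqxx eq_sym (negbTE ab).
set gaa := g a a x; set gab := g a b x; set gbb := g b b x.
by congr (_ < _); ring.
Qed.

Lemma metric_aa_gt0 x : U x -> 0 < g a a x.
Proof.
move=> Ux; have := @metric_form_gt0 x 1 0 Ux.
by rewrite oner_eq0 /= !mul1r !mulr0 !mul0r !addr0; exact.
Qed.

Lemma metric_det_gt0 x : U x -> 0 < metric_det x.
Proof.
move=> Ux; have g0 := metric_aa_gt0 Ux.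
(* At this vector the quadratic form takes the value [g a a x] times the determinant. *)
have := @metric_form_gt0 x (- g a b x) (g a a x) Ux.
rewrite (gt_eqF g0) orbT => /(_ isT).
move: g0; rewrite /metric_det; move: (g a a x) (g a b x) (g b b x) => p q r p0.
have -> : - q * - q * p + 2 * - q * p * q + p * p * r = p * (p * r - q * q).
  by ring.
by rewrite pmulr_rgt0.
Qed.

Lemma invmetricE x : U x ->
  [/\ invmetric a a x = g b b x / metric_det x,
      invmetric a b x = - g a b x / metric_det x,
      invmetric b a x = - g a b x / metric_det x &
      invmetric b b x = g a a x / metric_det x].
Proof.
move=> Ux; have D0 := lt0r_neq0 (metric_det_gt0 Ux).
pose K : 'M[R]_2 := \matrix_(i, j)
  ((if i == a then if j == a then g b b x else - g a b x
    else if j == a then - g a b x else g a a x) / metric_det x).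
have ba : (b == a) = false by rewrite eq_sym (negbTE ab).
have GK : G x *m K = 1%:M.
  have E i j : G x i j = g i j x by [].
  apply/matrixP => i j; rewrite mxE sumab !mxE !E eqxx ba.
  have GC := metricC b a Ux.
  have [->|->] := index_cases i; have [->|->] := index_cases j;
    rewrite ?GC ?eqxx ?ba ?(negbTE ab) /=; move: D0; rewrite /metric_det;
    by move: (g a a x) (g a b x) (g b b x) => p q r D0; field.
have [uG _] := mulmx1_unit GK.
have -> : invmetric = fun i j x => invmx (G x) i j by [].
have -> : invmx (G x) = K by rewrite -[LHS]mulmx1 -GK mulKmx.
by rewrite !mxE eqxx ba.
Qed.

Lemma smooth_metric i j : smooth_open U (g i j).
Proof. exact: smooth_coef. Qed.
Let sg := smooth_metric.

Lemma smooth_metric_det : smooth_open U metric_det.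
Proof. by rewrite /metric_det; smooth_tac. Qed.

Lemma smooth_invmetric i j : smooth_open U (invmetric i j).
Proof.
have sD := smooth_metric_det.
have sV : smooth_open U (fun x => (metric_det x)^-1).
  apply: smooth_inv => // x Ux; exact: lt0r_neq0 (metric_det_gt0 Ux).
have [->|->] := index_cases i; have [->|->] := index_cases j.
- apply: (@smooth_eq _ _ _ _ (fun x => g b b x / metric_det x)) => //.
    by move=> x /invmetricE[].
  exact: smooth_mul (sg b b) sV.
- apply: (@smooth_eq _ _ _ _ (fun x => - g a b x / metric_det x)) => //.
    by move=> x /invmetricE[].
  exact: smooth_mul (smooth_opp _ (sg a b)) sV.
- apply: (@smooth_eq _ _ _ _ (fun x => - g a b x / metric_det x)) => //.
    by move=> x /invmetricE[].
  exact: smooth_mul (smooth_opp _ (sg a b)) sV.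
- apply: (@smooth_eq _ _ _ _ (fun x => g a a x / metric_det x)) => //.
    by move=> x /invmetricE[].
  exact: smooth_mul (sg a a) sV.
Qed.
Let sh := smooth_invmetric.

Lemma invmetricC i j x : U x -> invmetric i j x = invmetric j i x.
Proof.
move=> Ux; have [E1 E2 E3 E4] := invmetricE Ux.
by have [->|->] := index_cases i; have [->|->] := index_cases j; rewrite ?E1 ?E2 ?E3.
Qed.

Lemma invmetric_aa_gt0 x : U x -> 0 < invmetric a a x.
Proof.
move=> Ux; have [-> _ _ _] := invmetricE Ux.
apply: divr_gt0 (metric_det_gt0 Ux).
have := @metric_form_gt0 x 0 1 Ux.
by rewrite oner_eq0 orbT !mul1r !mulr0 !mul0r !add0r; exact.
Qed.

Lemma invmetric_det_gt0 x : U x ->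
  0 < invmetric a a x * invmetric b b x - invmetric a b x * invmetric a b x.
Proof.
move=> Ux; have [-> -> _ ->] := invmetricE Ux.
have D0 := metric_det_gt0 Ux; have D1 := lt0r_neq0 D0.
rewrite [X in _ < X](_ : _ = (metric_det x)^-1) ?invr_gt0//.
move: D1; rewrite /metric_det; move: (g a a x) (g a b x) (g b b x) => p q r D1.
by field.
Qed.

Lemma mul_invmetric i m x : U x ->
  g i a x * invmetric a m x + g i b x * invmetric b m x = (i == m)%:R.
Proof.
move=> Ux; have [E1 E2 E3 E4] := invmetricE Ux.
have D1 := lt0r_neq0 (metric_det_gt0 Ux).
have ba : (b == a) = false by rewrite eq_sym (negbTE ab).
have gC := metricC b a Ux.
by have [->|->] := index_cases i; have [->|->] := index_cases m;
  rewrite ?gC ?E1 ?E2 ?E3 ?E4 ?eqxx ?ba ?(negbTE ab) /=; move: D1;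
  rewrite /metric_det; move: (g a a x) (g a b x) (g b b x) => p q r D1; field.
Qed.

Lemma christoffelE k i j x : christoffel G k i j x =
  2^-1 * (invmetric k a x * (partial i (g j a) x + partial j (g i a) x - partial a (g i j) x)
        + invmetric k b x * (partial i (g j b) x + partial j (g i b) x - partial b (g i j) x)).
Proof. by rewrite /christoffel sumab. Qed.

Lemma smooth_christoffel k i j : smooth_open U (christoffel G k i j).
Proof.
rewrite [christoffel _ _ _ _](funext (christoffelE k i j)).
have sg' p q r : smooth_open U (partial p (g q r)) by exact: smooth_partial.
by smooth_tac => x _; rewrite pnatr_eq0.
Qed.
Let sGam := smooth_christoffel.

Lemma partial_metricC k i j x : U x -> partial k (g i j) x = partial k (g j i) x.
Proof. by move=> Ux; apply: (partial_eq _ oU Ux) => y; exact: metricC. Qed.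

Lemma christoffelC k i j x : U x -> christoffel G k i j x = christoffel G k j i x.
Proof.
move=> Ux; rewrite !christoffelE !(partial_metricC _ j i Ux).
by rewrite ![partial i _ x + _]addrC.
Qed.

(** The derivative of an inverse matrix, obtained by differentiating the product of [g] and its
    inverse, which is constant. *)
Lemma partial_invmetric k m j x : U x -> partial k (invmetric m j) x =
  - (invmetric m a x * partial k (g a a) x * invmetric a j x
   + invmetric m a x * partial k (g a b) x * invmetric b j x
   + (invmetric m b x * partial k (g b a) x * invmetric a j x
   + invmetric m b x * partial k (g b b) x * invmetric b j x)).
Proof.
move=> Ux.
have E i : partial k (g i a) x * invmetric a j x + g i a x * partial k (invmetric a j) x
   + (partial k (g i b) x * invmetric b j x + g i b x * partial k (invmetric b j) x) = 0.
  transitivity (partial k (fun y => g i a y * invmetric a j y + g i b y * invmetric b j y) x).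
    by apply/esym; partial_tac.
  rewrite (partial_eq (w := fun=> (i == j)%:R) _ oU Ux).
    by rewrite /partial derive_cst.
  by move=> y Uy; rewrite mul_invmetric.
have I i l : invmetric i a x * g a l x + invmetric i b x * g b l x = (i == l)%:R.
  rewrite eq_sym -(mul_invmetric l i Ux) !(invmetricC i _ Ux).
  by rewrite !(metricC _ l Ux) mulrC [X in _ + X]mulrC.
have Ea := E a; have Eb := E b.
have Ia := I m a; have Ib := I m b.
(* The identity matrix, in Kronecker deltas, is inserted in front of the unknown derivative; written
   as inverse times [g], it makes the relations [Ea] and [Eb] applicable. *)
have J : partial k (invmetric m j) x = (m == a)%:R * partial k (invmetric a j) x
  + (m == b)%:R * partial k (invmetric b j) x.
  have ba : (b == a) = false by rewrite eq_sym (negbTE ab).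
  by have [->|->] := index_cases m; rewrite eqxx ?ba ?(negbTE ab) ?mul0r ?mul1r ?addr0 ?add0r.
rewrite J -Ia -Ib; apply: subr0_eq.
transitivity (invmetric m a x *
  (partial k (g a a) x * invmetric a j x + g a a x * partial k (invmetric a j) x
   + (partial k (g a b) x * invmetric b j x + g a b x * partial k (invmetric b j) x))
  + invmetric m b x *
  (partial k (g b a) x * invmetric a j x + g b a x * partial k (invmetric a j) x
   + (partial k (g b b) x * invmetric b j x + g b b x * partial k (invmetric b j) x)));
  last by rewrite Ea Eb !mulr0 addr0.
clear; ring_at x.
Qed.

(** The Levi-Civita property in its upper-index form: substituting the Christoffel formula into the
    right-hand side gives back [partial_invmetric]. It supplies the assumption on [h] and [Gam]
    behind Bochner's formula. *)
Lemma metric_connection k i j x : U x ->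
  partial k (invmetric i j) x
    = - (christoffel G i k a x * invmetric a j x
         + christoffel G i k b x * invmetric b j x)
      - (christoffel G j k a x * invmetric i a x
         + christoffel G j k b x * invmetric i b x).
Proof.
move=> Ux; rewrite partial_invmetric// !christoffelE.
rewrite !(partial_metricC k b a Ux) !(invmetricC j _ Ux).
clear; abstract_at x.
by intros; field.
Qed.
Let mc := metric_connection.

Lemma local_gradE u x i : local_grad G u x 0 i =
  invmetric i a x * partial a u x + invmetric i b x * partial b u x.
Proof. by rewrite mxE sumab. Qed.

(** Because the inverse metric is parallel, the divergence of the gradient is the trace of the
    Hessian. *)
Lemma local_laplacianE u x : smooth_open U u -> U x ->
  local_laplacian G u x = lap a b invmetric (christoffel G) u x.
Proof.
move=> su Ux; rewrite /local_laplacian /local_div !sumab !local_gradE.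
have P i : partial i (fun y => local_grad G u y 0 i) x =
  partial i (invmetric i a) x * partial a u x + invmetric i a x * partial i (partial a u) x
  + (partial i (invmetric i b) x * partial b u x + invmetric i b x * partial i (partial b u) x).
  rewrite (_ : (fun y => _) = fun y => invmetric i a y * partial a u y + invmetric i b y * partial b u y).
    by partial_tac.
  by apply/funext => y; exact: local_gradE.
rewrite !P !mc// /lap /hess.
rewrite !(christoffelC _ b a Ux) !(invmetricC b a Ux) !(partialC b a oU su Ux).
clear; ring_at x.
Qed.

Lemma gradsq_ge0 u x : U x -> 0 <= gradsq a b invmetric u x.
Proof.
move=> Ux; rewrite -(pmulr_rge0 _ (invmetric_aa_gt0 Ux)) /gradsq /dot2.
have := invmetric_det_gt0 Ux; rewrite (invmetricC b a Ux).
move: (invmetric a a x) (invmetric a b x) (invmetric b b x) => p q r D0.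
move: (partial a u x) (partial b u x) => v w.
have -> : p * (p * v * v + q * v * w + (q * w * v + r * w * w))
  = (p * v + q * w) ^+ 2 + (p * r - q * q) * w ^+ 2 by ring.
by rewrite addr_ge0 ?sqr_ge0// mulr_ge0 ?sqr_ge0// ltW.
Qed.

Lemma local_norm_gradE u x : U x ->
  local_norm G x (local_grad G u x) ^+ 2 = gradsq a b invmetric u x.
Proof.
move=> Ux; suff E : (local_grad G u x *m G x *m (local_grad G u x)^T) 0 0
    = gradsq a b invmetric u x.
  by rewrite /local_norm E sqr_sqrtr// gradsq_ge0.
set v := local_grad G u x.
(* Lowering the index of the gradient gives back du. *)
have W i : v 0 a * g a i x + v 0 b * g b i x = partial i u x.
  rewrite !local_gradE.
  have := mul_invmetric i a Ux; have := mul_invmetric i b Ux.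
  rewrite !(metricC _ i Ux) (invmetricC b a Ux).
  have ba : (b == a) = false by rewrite eq_sym (negbTE ab).
  move=> Eb Ea; transitivity (
    (g i a x * invmetric a a x + g i b x * invmetric a b x) * partial a u x
    + (g i a x * invmetric a b x + g i b x * invmetric b b x) * partial b u x).
    by clear; ring_at x.
  rewrite Ea Eb; have [->|->] := index_cases i;
    by rewrite eqxx ?ba ?(negbTE ab) mul1r mul0r ?addr0 ?add0r.
have E i j : G x i j = g i j x by [].
rewrite mxE sumab ![(v *m G x) _ _]mxE !sumab ![v^T _ _]mxE !E !W /v !local_gradE.
by rewrite /gradsq /dot2; clear; ring_at x.
Qed.

(** In the Ricci contraction only the index different from the first Ricci index survives, which
    gives [Ra] and [Rb]. Tracing yields two halves, and [curv_antisym] for the pair [a], [b]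
    identifies each with [gauss]. *)
Lemma local_scalar_curvatureE x : U x ->
  local_scalar_curvature G x = 2 * gauss a b invmetric (christoffel G) x.
Proof.
move=> Ux; pose K := curv a b (christoffel G).
have Ra k : ricci G a k x = - K b k x.
  rewrite /ricci sumab /riemann !sumab /K /curv.
  by clear; ring_at x.
have Rb k : ricci G b k x = K a k x.
  rewrite /ricci sumab /riemann !sumab /K /curv.
  by clear; ring_at x.
rewrite /local_scalar_curvature !sumab !Ra !Rb /gauss -/K.
have := curv_antisym oU sh sGam mc a b Ux.
have E i j : invmx (G x) i j = invmetric i j x by [].
rewrite -/K !E (invmetricC b a Ux) => CA; apply: subr0_eq; rewrite -[RHS]oppr0 -CA.
by clear; ring_at x.
Qed.

Definition flux_a (u : 'rV[R]_2 -> R) x : R :=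
  g b b x * partial a u x - g a b x * partial b u x.

Definition flux_b (u : 'rV[R]_2 -> R) x : R :=
  g a a x * partial b u x - g a b x * partial a u x.

(* [flux] is [det g] times the gradient, so that no inverse matrix occurs in
   this form of the Laplacian. *)
Lemma local_laplacian_flux u x : smooth_open U u -> U x ->
  2 * metric_det x ^+ 2 * local_laplacian G u x =
  2 * metric_det x * (partial a (flux_a u) x + partial b (flux_b u) x)
  - (flux_a u x * partial a metric_det x + flux_b u x * partial b metric_det x).
Proof.
move=> su Ux.
have Pa : partial a (flux_a u) x = partial a (g b b) x * partial a u x
   + g b b x * partial a (partial a u) x
   - (partial a (g a b) x * partial b u x + g a b x * partial a (partial b u) x).
  by rewrite /flux_a; partial_tac; reflexivity.
have Pb : partial b (flux_b u) x = partial b (g a a) x * partial b u x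
   + g a a x * partial b (partial b u) x
   - (partial b (g a b) x * partial a u x + g a b x * partial b (partial a u) x).
  by rewrite /flux_b; partial_tac; reflexivity.
have PD i : partial i metric_det x = partial i (g a a) x * g b b x
   + g a a x * partial i (g b b) x
   - (partial i (g a b) x * g a b x + g a b x * partial i (g a b) x).
  by rewrite /metric_det; partial_tac; reflexivity.
have [E1 E2 E3 E4] := invmetricE Ux.
have D0 := lt0r_neq0 (metric_det_gt0 Ux).
(* With D the determinant, this is the divergence formula [D^(-1/2) d_i (D^(-1/2) flux^i)]
   multiplied by [2 D^2], which clears the square roots. *)
rewrite local_laplacianE// Pa Pb !PD /lap /hess !christoffelE E1 E2 E3 E4.
rewrite /flux_a /flux_b !(partial_metricC _ b a Ux) (partialC b a oU su Ux).
move: D0; rewrite /metric_det; clear.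
abstract_at x.
by intros; field.
Qed.

End local_geometry.

(** * Change of charts *)

Section chart_change.
Context {R : realType}.
Variables (U1 U2 W : set 'rV[R]_2) (G1 G2 : 'rV[R]_2 -> 'M[R]_2).
Variable phi : 'rV[R]_2 -> 'rV[R]_2.
Hypothesis oU1 : open U1.
Hypothesis oU2 : open U2.
Hypothesis oW : open W.
Hypothesis sG1 : smooth_open U1 G1.
Hypothesis sG2 : smooth_open U2 G2.
Hypothesis symG1 : forall x, U1 x -> (G1 x)^T = G1 x.
Hypothesis symG2 : forall x, U2 x -> (G2 x)^T = G2 x.
Hypothesis posG1 : forall x, U1 x -> forall v : 'rV[R]_2, v != 0 ->
  0 < (v *m G1 x *m v^T) 0 0.
Hypothesis posG2 : forall x, U2 x -> forall v : 'rV[R]_2, v != 0 ->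
  0 < (v *m G2 x *m v^T) 0 0.
Hypothesis WU1 : W `<=` U1.
Hypothesis phiU2 : forall x, W x -> U2 (phi x).
Hypothesis sphi : smooth_open W phi.
Hypothesis compat : forall x, W x ->
  G1 x = 'J phi x *m G2 (phi x) *m ('J phi x)^T.
Variables a b : 'I_2.
Hypothesis sumab : forall F : 'I_2 -> R, \sum_i F i = F a + F b.
Hypothesis ab : a != b.

Let phic (c : 'I_2) (x : 'rV[R]_2) : R := phi x 0 c.
Let Jac (i c : 'I_2) := partial i (phic c).

Let del x := Jac a a x * Jac b b x - Jac a b x * Jac b a x.

Let sphic c : smooth_open W (phic c).
Proof. exact: smooth_coef. Qed.

Let sJac i c : smooth_open W (Jac i c).
Proof. exact: smooth_partial. Qed.

Let sdel : smooth_open W del.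
Proof. by rewrite /del; smooth_tac. Qed.

Lemma differentiable_chart x : W x -> differentiable phi x.
Proof.
move=> Wx; apply: differentiable_rV => c.
exact: (smooth_differentiable oW (sphic c) Wx).
Qed.

Lemma jacobianE i c x : W x -> 'J phi x i c = Jac i c x.
Proof.
move=> Wx; have := deriveEjacobian (delta_mx 0 i) (differentiable_chart Wx).
rewrite -rowE => /(congr1 (fun v : 'rV[R]_2 => v 0 c)).
rewrite [RHS]mxE => <-.
by rewrite -(derive_coef _ _ _ sphi Wx).
Qed.

Lemma partial_pullback F i x : smooth_open U2 F -> W x ->
  is_derive x (delta_mx 0 i) (fun y => F (phi y))
    (Jac i a x * partial a F (phi x) + Jac i b x * partial b F (phi x)).
Proof.
move=> sF Wx.
have dF := smooth_differentiable oU2 sF (phiU2 Wx).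
apply: is_derive_eq (derive_comp_rV _ (differentiable_chart Wx) dF) _.
by rewrite sumab -!(derive_coef _ _ _ sphi Wx).
Qed.

Lemma JacC i j c x : W x -> partial i (Jac j c) x = partial j (Jac i c) x.
Proof. by move=> Wx; exact: (partialC i j oW (sphic c) Wx). Qed.

Local Notation g1 := (metric_ent G1).
Local Notation g2 := (metric_ent G2).

Lemma metric_pullback i j x : W x -> g1 i j x =
  Jac i a x * Jac j a x * g2 a a (phi x) + Jac i b x * Jac j a x * g2 b a (phi x)
  + (Jac i a x * Jac j b x * g2 a b (phi x) + Jac i b x * Jac j b x * g2 b b (phi x)).
Proof.
move=> Wx; rewrite {1}/metric_ent compat// mxE sumab ![(_ *m G2 _) _ _]mxE !sumab.
rewrite ![_^T _ _]mxE !jacobianE//.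
have E p q : G2 (phi x) p q = g2 p q (phi x) by [].
rewrite !E; by clear; abstract_at (phi x); ring_at x.
Qed.

Variables u1 u2 : 'rV[R]_2 -> R.
Hypothesis su1 : smooth_open U1 u1.
Hypothesis su2 : smooth_open U2 u2.
Hypothesis u12 : forall x, W x -> u1 x = u2 (phi x).

Let D2 x := metric_det G2 a b (phi x).
Let Ya x := flux_a G2 a b u2 (phi x).
Let Yb x := flux_b G2 a b u2 (phi x).

Lemma partial_u1 i x : W x -> partial i u1 x =
  Jac i a x * partial a u2 (phi x) + Jac i b x * partial b u2 (phi x).
Proof.
move=> Wx; rewrite (partial_eq i oW Wx u12).
by have [_] := partial_pullback i su2 Wx.
Qed.

Lemma metric_det_pullback x : W x -> metric_det G1 a b x =
  del x
  * del x * D2 x.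
Proof.
move=> Wx; rewrite /del /metric_det /D2 /metric_det !metric_pullback//.
rewrite (metricC symG2 b a (phiU2 Wx)); by clear; abstract_at (phi x); ring_at x.
Qed.

(** The gradient transforms by the inverse Jacobian and the determinant of the metric by [del]
    squared; their product therefore involves [del] times the cofactor matrix, and no division. *)
Lemma flux_a_pullback x : W x -> flux_a G1 a b u1 x =
  del x
  * (Jac b b x * Ya x - Jac b a x * Yb x).
Proof.
move=> Wx; rewrite /del /Ya /Yb /flux_a /flux_b !metric_pullback// !partial_u1//.
rewrite (metricC symG2 b a (phiU2 Wx)); by clear; abstract_at (phi x); ring_at x.
Qed.

Lemma flux_b_pullback x : W x -> flux_b G1 a b u1 x =
  del x
  * (Jac a a x * Yb x - Jac a b x * Ya x).
Proof.
move=> Wx; rewrite /del /Ya /Yb /flux_a /flux_b !metric_pullback// !partial_u1//.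
rewrite (metricC symG2 b a (phiU2 Wx)); by clear; abstract_at (phi x); ring_at x.
Qed.

(** Both sides are compared after multiplication by [2 * metric_det G1 a b x ^+ 2], where
    [local_laplacian_flux] makes them polynomial in the Jacobian and in the data of the second
    chart. *)
Lemma local_laplacian_pullback x : W x ->
  local_laplacian G1 u1 x = local_laplacian G2 u2 (phi x).
Proof.
move=> Wx.
have d0 := lt0r_neq0 (metric_det_gt0 symG1 posG1 sumab ab (WU1 Wx)).
have sg2 := smooth_metric oU2 sG2.
have sD2 : smooth_open U2 (metric_det G2 a b) by rewrite /metric_det; smooth_tac.
have sYa2 : smooth_open U2 (flux_a G2 a b u2) by rewrite /flux_a; smooth_tac.
have sYb2 : smooth_open U2 (flux_b G2 a b u2) by rewrite /flux_b; smooth_tac.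
have PD i : partial i (metric_det G1 a b) x =
  2 * partial i del x * del x * D2 x + del x * del x
  * (Jac i a x * partial a (metric_det G2 a b) (phi x)
     + Jac i b x * partial b (metric_det G2 a b) (phi x)).
  rewrite (partial_eq i oW Wx metric_det_pullback).
  have dD := partial_pullback i sD2 Wx; rewrite -/D2 in dD; partial_tac.
  by clear; abstract_at (phi x); ring_at x.
have PYa : partial a (flux_a G1 a b u1) x =
  partial a del x * (Jac b b x * Ya x - Jac b a x * Yb x) + del x *
  (partial a (Jac b b) x * Ya x - partial a (Jac b a) x * Yb x
   + Jac b b x * (Jac a a x * partial a (flux_a G2 a b u2) (phi x)
     + Jac a b x * partial b (flux_a G2 a b u2) (phi x))
   - Jac b a x * (Jac a a x * partial a (flux_b G2 a b u2) (phi x)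
     + Jac a b x * partial b (flux_b G2 a b u2) (phi x))).
  rewrite (partial_eq a oW Wx flux_a_pullback).
  have dYa := partial_pullback a sYa2 Wx; have dYb := partial_pullback a sYb2 Wx.
  rewrite -/Ya -/Yb in dYa dYb; partial_tac.
  by clear; abstract_at (phi x); ring_at x.
have PYb : partial b (flux_b G1 a b u1) x =
  partial b del x * (Jac a a x * Yb x - Jac a b x * Ya x) + del x *
  (partial b (Jac a a) x * Yb x - partial b (Jac a b) x * Ya x
   + Jac a a x * (Jac b a x * partial a (flux_b G2 a b u2) (phi x)
     + Jac b b x * partial b (flux_b G2 a b u2) (phi x))
   - Jac a b x * (Jac b a x * partial a (flux_a G2 a b u2) (phi x)
     + Jac b b x * partial b (flux_a G2 a b u2) (phi x))).
  rewrite (partial_eq b oW Wx flux_b_pullback).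
  have dYa := partial_pullback b sYa2 Wx; have dYb := partial_pullback b sYb2 Wx.
  rewrite -/Ya -/Yb in dYa dYb; partial_tac.
  by clear; abstract_at (phi x); ring_at x.
have E1 := local_laplacian_flux oU1 sG1 symG1 posG1 sumab ab su1 (WU1 Wx).
have E2 := local_laplacian_flux oU2 sG2 symG2 posG2 sumab ab su2 (phiU2 Wx).
have q0 : 2 * metric_det G1 a b x ^+ 2 != 0 by rewrite mulf_neq0 ?expf_neq0 ?pnatr_eq0.
apply: (mulfI q0); rewrite E1 PYa PYb !PD.
rewrite metric_det_pullback// flux_a_pullback// flux_b_pullback//.
(* Second derivatives of the chart change now cancel: the cofactor matrix of a Jacobian is
   divergence free. *)
rewrite (JacC b a a Wx) (JacC b a b Wx).
transitivity (del x ^+ 4 * (2 * metric_det G2 a b (phi x) ^+ 2 * local_laplacian G2 u2 (phi x))).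
  rewrite E2 -/(Ya x) -/(Yb x) -/(D2 x).
  move: (partial a del x) (partial b del x) => v w; rewrite /del.
  by clear; abstract_at (phi x); ring_at x.
by rewrite /D2; clear; abstract_at (phi x); ring_at x.
Qed.

End chart_change.

(** * Minimum principle *)

Section extrema.
Context {R : realType}.

(** Difference quotients with a negative step are nonpositive here. One side must suffice, since a
    minimum over a closed time interval can sit at its right end. *)
Lemma derive_left_min_le0 (F : R -> R) (t d : R) : is_derive t 1 F d ->
  (\forall s \near t, s <= t -> F t <= F s) -> d <= 0.
Proof.
move=> [dF <-] Fmin; rewrite leNgt; apply/negP => d0.
have : \forall h \near 0^', 0 < h^-1 *: ((F \o shift t) (h *: 1) - F t).
  exact: (cvgr_gt _ dF).
rewrite /dnbhs => /nbhs_ballP[e /= e0 He].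
move/nbhs_ballP : Fmin => [r /= r0 Hr].
pose m := Num.min e r / 2.
have m0 : 0 < m by rewrite divr_gt0// lt_min e0.
have : m < Num.min e r by rewrite ltr_pdivrMr// ltr_pMr ?ltr1n// lt_min e0.
rewrite lt_min => /andP[me mr].
have := He (- m); rewrite /ball /= opprK add0r gtr0_norm//.
move=> /(_ me); rewrite oppr_eq0 gt_eqF// => /(_ isT).
rewrite [_%:A]mulr1 => q0.
have : F t <= F (- m + t).
  apply: Hr; last by rewrite gerDr oppr_le0 ltW.
  by rewrite /ball /= opprD opprK addrCA subrr addr0 gtr0_norm.
rewrite -subr_ge0 => F0; move: q0; rewrite ltNge; apply/negP; rewrite negbK.
by apply: mulr_le0_ge0 => //; rewrite invr_le0 oppr_le0 ltW.
Qed.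

Lemma smooth_local_min n (U : set 'rV[R]_n) (F : 'rV[R]_n -> R) x v : open U -> smooth_open U F ->
  U x -> (forall y, U y -> F x <= F y) ->
  'D_v F x = 0 /\ 0 <= 'D_v ('D_v F) x.
Proof.
move=> oU sF Ux Fmin.

have line w : \forall s \near (0 : R), U (x + s *: w).
  have c : {for (0 : R), continuous (fun s : R => x + s *: w)}.
    by apply: continuousD; [exact: cst_continuous|exact: scalel_continuous].
  by apply: c; rewrite scale0r addr0; exact: open_nbhs_nbhs.
have le0 w : 'D_w F x <= 0.
  have dl : is_derive (0 : R) 1 (fun s : R => F (x + s *: w)) ('D_w F x).
    have := @is_derive_line _ _ _ F x w 0; rewrite scale0r addr0; apply.
    exact: smooth_derivable sF Ux.
  apply: (derive_left_min_le0 dl); near=> s => _.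
  by rewrite scale0r addr0; apply: Fmin; near: s; exact: line.
have D0 w : 'D_w F x = 0.
  apply/eqP; rewrite eq_le le0 /= -oppr_le0.
  have dF := smooth_differentiable oU sF Ux.
  by rewrite deriveE// -linearN -deriveE.
(* As the first derivative vanishes at [x], two uses of the mean value theorem write
   [F (x + m *: v) - F x] as a positive multiple of a second derivative near [x], which would be
   negative. *)
split=> //; rewrite leNgt; apply/negP => DD0.
have sD := smooth_derive v sF; have sDD := smooth_derive v sD.
have : \forall y \near x, U y /\ 'D_v ('D_v F) y < 0.
  near=> y; split; near: y; first exact: open_nbhs_nbhs.
  exact: (cvgr_lt _ (smooth_continuous sDD Ux)).
move=> /nbhs_ballP[e /= e0 eU].
(* With this choice the segment stays within [e / 2] of [x], also when [v = 0]. *)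
pose m := e / (2 * (`|v| + 1)).
have v1 : 0 < `|v| + 1 by rewrite ltr_wpDl.
have m0 : 0 < m by rewrite divr_gt0// mulr_gt0.
have inU (s : R) : 0 <= s <= 1 -> U (x + (s * m) *: v) /\ 'D_v ('D_v F) (x + (s * m) *: v) < 0.
  move=> /andP[s0 s1]; apply: eU; rewrite -ball_normE /= opprD addNKr normrN normrZ.
  have sm0 : 0 <= s * m by rewrite mulr_ge0// ltW.
  rewrite (ger0_norm sm0); apply: (@le_lt_trans _ _ (m * (`|v| + 1))).
    by apply: ler_pM => //; rewrite ?lerDl// ler_piMl// ltW.
  rewrite /m invfM mulrA divfK ?gt_eqF// ltr_pdivrMr// ltr_pMr// ltr1n.
  by [].
have dF (s : R) : 0 <= s <= 1 -> derivable F (x + (s * m) *: v) v.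
  by move=> /inU[Us _]; exact: smooth_derivable sF Us.
have [s /andP[s0 s1] Es] := MVT_line dF.
have inUs (q : R) : 0 <= q <= 1 -> 0 <= q * s <= 1.
  move=> /andP[q0 q1]; rewrite mulr_ge0//=; last exact: ltW.
  by rewrite mulr_ile1// ltW.
have dDF (q : R) : 0 <= q <= 1 -> derivable ('D_v F) (x + (q * (s * m)) *: v) v.
  by move=> /inUs; rewrite mulrA => /inU[Us _]; exact: smooth_derivable sD Us.
have [q /andP[q0 q1] Eq] := MVT_line dDF.
have F1 : F x <= F (x + m *: v).
  by apply: Fmin; have [] := inU 1; rewrite ?ler01 ?lexx// mul1r.
have [_] : U (x + (q * s * m) *: v) /\ 'D_v ('D_v F) (x + (q * s * m) *: v) < 0.
  by apply: inU; apply: inUs; rewrite !ltW.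
rewrite -mulrA => N.
move: F1; rewrite -subr_ge0 Es pmulr_rge0//.
move: Eq; rewrite (D0 v) subr0 => ->; rewrite pmulr_rge0 ?mulr_gt0//.
by rewrite leNgt N.
Unshelve. all: by end_near.
Qed.

End extrema.

(** * Locality, linearity and the logarithm under the Laplacian *)

Section lap_calculus.
Context {R : realType}.
Variables a b : 'I_2.
Variables (h : 'I_2 -> 'I_2 -> 'rV[R]_2 -> R)
  (Gam : 'I_2 -> 'I_2 -> 'I_2 -> 'rV[R]_2 -> R).
Variable W : set 'rV[R]_2.
Hypothesis oW : open W.
Implicit Types u v w F : 'rV[R]_2 -> R.
Local Notation lap := (lap a b h Gam).
Local Notation gradsq := (gradsq a b h).

Lemma lap_eq u w x : W x -> (forall y, W y -> u y = w y) -> lap u x = lap w x.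
Proof.
move=> Wx uw; have P k y : W y -> partial k u y = partial k w y.
  by move=> Wy; exact: (partial_eq k oW Wy uw).
have PP j k : partial j (partial k u) x = partial j (partial k w) x.
  exact: (partial_eq j oW Wx (P k)).
by rewrite /lap /hess !PP !P.
Qed.

Lemma gradsq_eq u w x : W x -> (forall y, W y -> u y = w y) ->
  gradsq u x = gradsq w x.
Proof.
move=> Wx uw; have P k : partial k u x = partial k w x.
  exact: (partial_eq k oW Wx uw).
by rewrite /gradsq /dot2 !P.
Qed.

Lemma lapDB u v w x : smooth_open W u -> smooth_open W v -> smooth_open W w ->
  W x -> lap (fun y => u y + v y - w y) x = lap u x + lap v x - lap w x.
Proof.
move=> su sv sw Wx.
have P k y : W y -> partial k (fun y => u y + v y - w y) y =
    partial k u y + partial k v y - partial k w y.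
  by move=> Wy; partial_tac; reflexivity.
have PP j k : partial j (partial k (fun y => u y + v y - w y)) x =
    partial j (partial k u) x + partial j (partial k v) x - partial j (partial k w) x.
  by rewrite (partial_eq j oW Wx (P k)); partial_tac; reflexivity.
move: P PP; rewrite /lap /hess; move: (fun y => u y + v y - w y) => s.
move: (@partial R 2) => D P PP; rewrite !PP !(P _ _ Wx).
by clear; ring_at x.
Qed.

Lemma lap_ln F x : smooth_open W F -> (forall y, W y -> 0 < F y) -> W x ->
  lap (fun y => ln (F y)) x = (F x)^-1 * lap F x - gradsq (fun y => ln (F y)) x.
Proof.
move=> sF F0 Wx.
(* An opaque name for the reciprocal of [F], so that differentiation treats it as an atom whose
   derivative is [dV]. *)
have [iF iFE] : exists iF, forall y, iF y = (F y)^-1 by exists (fun y => (F y)^-1).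
have P k y : W y -> partial k (fun y => ln (F y)) y = iF y * partial k F y.
  move=> Wy; rewrite iFE; apply: partial_val (derive_lnf (F0 y Wy) _) erefl.
  exact: smooth_is_partial sF Wy.
have PP j k : partial j (partial k (fun y => ln (F y))) x =
    iF x * partial j (partial k F) x
    - iF x * iF x * partial j F x * partial k F x.
  have dV := derive_invf (lt0r_neq0 (F0 x Wx)) (smooth_is_partial j sF Wx).
  rewrite -iFE -(funext iFE) in dV.
  rewrite (partial_eq j oW Wx (P k)); partial_tac.
  by clear; ring_at x.
move: P PP; rewrite -iFE /gradsq /dot2 /lap /hess; move: (fun y => ln (F y)) => s.
move: (@partial R 2) => D P PP; rewrite !PP !(P _ _ Wx).
by clear; ring_at x.
Qed.

End lap_calculus.

(** * The Laplacian on space-time functions *)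

Section spacetime.
Context {R : realType}.
Variables a b : 'I_2.
Variables (h : 'I_2 -> 'I_2 -> 'rV[R]_2 -> R)
  (Gam : 'I_2 -> 'I_2 -> 'I_2 -> 'rV[R]_2 -> R).
Implicit Types v w : 'rV[R]_2 * R -> R.

Definition spatial (k : 'I_2) v : 'rV[R]_2 * R -> R := 'D_(delta_mx 0 k, 0) v.
Definition dtime v : 'rV[R]_2 * R -> R := 'D_(0, 1) v.

(** The spatial Laplacian written with derivatives on the product space, so that the result is again
    a smooth space-time function and can be differentiated in time. *)
Definition lapst v z : R :=
    h a a z.1 * (spatial a (spatial a v) z
       - (Gam a a a z.1 * spatial a v z + Gam b a a z.1 * spatial b v z))
  + h a b z.1 * (spatial a (spatial b v) z
       - (Gam a a b z.1 * spatial a v z + Gam b a b z.1 * spatial b v z))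
  + (h b a z.1 * (spatial b (spatial a v) z
       - (Gam a b a z.1 * spatial a v z + Gam b b a z.1 * spatial b v z))
  + h b b z.1 * (spatial b (spatial b v) z
       - (Gam a b b z.1 * spatial a v z + Gam b b b z.1 * spatial b v z))).

Lemma partial_slice v k (t : R) :
  partial k (fun y => v (y, t)) = fun y => spatial k v (y, t).
Proof. by apply/funext => y; exact: derive_slicel. Qed.

Lemma lap_slice v y (t : R) :
  lap a b h Gam (fun y => v (y, t)) y = lapst v (y, t).
Proof. by rewrite /lap /hess !partial_slice. Qed.

Variables (U : set 'rV[R]_2) (O : set ('rV[R]_2 * R)).
Hypothesis oU : open U.
Hypothesis sh : forall i j, smooth_open U (h i j).
Hypothesis sGam : forall k i j, smooth_open U (Gam k i j).
Hypothesis oO : open O.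
Hypothesis OU : forall z, O z -> U z.1.

Lemma smooth_spatial k v : smooth_open O v -> smooth_open O (spatial k v).
Proof. exact: smooth_derive. Qed.

Lemma smooth_lapst v : smooth_open O v -> smooth_open O (lapst v).
Proof.
move=> sv.
have OUT : O `<=` U `*` [set: R] by move=> z /OU.
have sh' i j : smooth_open O (fun z => h i j z.1).
  by apply: smooth_sub OUT _; exact: smooth_fst.
have sG' k i j : smooth_open O (fun z => Gam k i j z.1).
  by apply: smooth_sub OUT _; exact: smooth_fst.
have s1 k := smooth_spatial k sv.
have s2 j k := smooth_spatial j (s1 k).
have T j k : smooth_open O (fun z => h j k z.1 * (spatial j (spatial k v) z
       - (Gam a j k z.1 * spatial a v z + Gam b j k z.1 * spatial b v z))).
  exact: (smooth_mul oO (sh' j k) (smooth_add oO (s2 j k) (smooth_opp oO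
    (smooth_add oO (smooth_mul oO (sG' a j k) (s1 a))
                   (smooth_mul oO (sG' b j k) (s1 b)))))).
exact: (smooth_add oO (smooth_add oO (T a a) (T a b))
                      (smooth_add oO (T b a) (T b b))).
Qed.

Lemma dtime_spatial k v z : smooth_open O v -> O z ->
  dtime (spatial k v) z = spatial k (dtime v) z.
Proof. by move=> sv Oz; exact: smooth_schwarz sv Oz. Qed.

Lemma dtime_spatial2 j k v z : smooth_open O v -> O z ->
  dtime (spatial j (spatial k v)) z = spatial j (spatial k (dtime v)) z.
Proof.
move=> sv Oz; rewrite (dtime_spatial j (smooth_spatial k sv) Oz).
rewrite /spatial; apply: near_eq_derive; apply: (near_open oO Oz) => y Oy.
exact: (dtime_spatial k sv Oy).
Qed.

Lemma is_derive_dtime v x (t : R) : smooth_open O v -> O (x, t) ->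
  is_derive t 1 (fun s => v (x, s)) (dtime v (x, t)).
Proof.
move=> sv Oxt; split; last exact: derive_slicer.
have : derivable v (x, t) (0, 1) := smooth_derivable sv Oxt.
rewrite /derivable; set d := (fun k : R => _); set d' := (fun k : R => _).
suff -> : d = d' by []; apply/funext => k; rewrite /d /d' /=.
have -> : k *: (0, 1) + (x, t) = (k *: 0 + x, k *: 1 + t) :> _ * R by [].
by rewrite scaler0 add0r.
Qed.

(** The time derivative passes through the coefficients, which are constant in time, and commutes
    with the spatial derivatives by Schwarz. *)
Lemma dtime_lapst v x (t : R) : smooth_open O v -> O (x, t) ->
  is_derive t 1 (fun s => lapst v (x, s)) (lapst (dtime v) (x, t)).
Proof.
move=> sv Oxt; have s1 k := smooth_spatial k sv.
have s2 j k := smooth_spatial j (s1 k).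
have T j k : is_derive t 1 (fun s => h j k x * (spatial j (spatial k v) (x, s)
     - (Gam a j k x * spatial a v (x, s) + Gam b j k x * spatial b v (x, s))))
  (h j k x * (spatial j (spatial k (dtime v)) (x, t)
     - (Gam a j k x * spatial a (dtime v) (x, t) + Gam b j k x * spatial b (dtime v) (x, t)))).
  have d1 l : is_derive t 1 (fun s => spatial l v (x, s)) (spatial l (dtime v) (x, t)).
    by rewrite -(dtime_spatial l sv Oxt); exact: (is_derive_dtime (s1 l) Oxt).
  have d2 : is_derive t 1 (fun s => spatial j (spatial k v) (x, s))
      (spatial j (spatial k (dtime v)) (x, t)).
    by rewrite -(dtime_spatial2 j k sv Oxt); exact: (is_derive_dtime (s2 j k) Oxt).
  have M (c : R) f df : is_derive t 1 f df -> is_derive t 1 (fun s : R => c * f s) (c * df).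
    move=> df'; apply: is_derive_eq (derive_mulf (derive_cstf c t 1) df') _.
    by rewrite mul0r add0r.
  exact: (M _ _ _ (derive_addf d2 (derive_oppf (derive_addf (M _ _ _ (d1 a)) (M _ _ _ (d1 b)))))).
exact: (derive_addf (derive_addf (T a a) (T a b)) (derive_addf (T b a) (T b b))).
Qed.

End spacetime.

Lemma second_derivative_test (R : realType) (W : set 'rV[R]_2) (F : 'rV[R]_2 -> R)
  (a b : 'I_2) x : open W -> (forall f : 'I_2 -> R, \sum_i f i = f a + f b) ->
  a != b -> smooth_open W F -> W x -> (forall y, W y -> F x <= F y) ->
  forall c d, 0 <= c * c * partial a (partial a F) x
     + 2 * c * d * partial a (partial b F) x + d * d * partial b (partial b F) x.
Proof.
move=> oW sumab ab sF Wx Fmin c d.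
pose v : 'rV[R]_2 := \row_i if i == a then c else d.
have vE H y : smooth_open W H -> W y ->
    'D_v H y = c * partial a H y + d * partial b H y.
  move=> sH Wy.
  rewrite derive_coordE; last exact: (smooth_differentiable oW sH Wy).
  by rewrite sumab !mxE eqxx eq_sym (negbTE ab).
have sP : smooth_open W (fun y => c * partial a F y + d * partial b F y).
  have sc (e : R) k := smooth_mul oW (smooth_cst oW e) (smooth_partial k sF).
  exact: (smooth_add oW (sc c a) (sc d b)).
have [_] := smooth_local_min v oW sF Wx Fmin.
have -> : 'D_v ('D_v F) x = 'D_v (fun y => c * partial a F y + d * partial b F y) x.
  apply: near_eq_derive; apply: (near_open oW Wx) => y Wy.
  exact: vE.
rewrite (vE _ _ sP Wx).
have P k : partial k (fun y => c * partial a F y + d * partial b F y) x =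
   c * partial k (partial a F) x + d * partial k (partial b F) x.
  partial_tac.
  by clear; ring_at x.
rewrite !P (partialC b a oW sF Wx).
move: (partial a (partial a F) x) (partial a (partial b F) x)
  (partial b (partial b F) x) => p q r.
suff -> : c * (c * p + d * q) + d * (c * q + d * r)
  = c * c * p + 2 * c * d * q + d * d * r by [].
by ring.
Qed.

Lemma lap_critical (R : realType) (a b : 'I_2) (h : 'I_2 -> 'I_2 -> 'rV[R]_2 -> R)
  (Gam : 'I_2 -> 'I_2 -> 'I_2 -> 'rV[R]_2 -> R) F x :
  (forall k, partial k F x = 0) -> h b a x = h a b x ->
  partial b (partial a F) x = partial a (partial b F) x ->
  lap a b h Gam F x =
  h a a x * partial a (partial a F) x + h a b x * partial a (partial b F) x
  + (h a b x * partial a (partial b F) x + h b b x * partial b (partial b F) x).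
Proof.
rewrite /lap /hess; move: (@partial R 2) F => D F D0 hba Dba.
by rewrite !D0 hba Dba; clear; ring_at x.
Qed.

Lemma dot2_eq0 (R : realType) (a b : 'I_2) (h : 'I_2 -> 'I_2 -> 'rV[R]_2 -> R)
  (v w : 'I_2 -> 'rV[R]_2 -> R) x : (forall k, w k x = 0) -> dot2 a b h v w x = 0.
Proof. by move=> w0; rewrite /dot2 !w0 !mulr0 !addr0. Qed.

Lemma lap_sqr_le (R : realType) (a b : 'I_2) (h : 'I_2 -> 'I_2 -> 'rV[R]_2 -> R)
  (Gam : 'I_2 -> 'I_2 -> 'I_2 -> 'rV[R]_2 -> R) u x :
  0 < h a a x -> 0 < h a a x * h b b x - h a b x * h a b x ->
  h b a x = h a b x -> hess a b Gam u b a x = hess a b Gam u a b x ->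
  lap a b h Gam u x ^+ 2 <= 2 * hess_sq a b h Gam u x.
Proof.
rewrite /lap /hess_sq /dot2; move: (hess a b Gam u) => H h0 D0 hba Hba.
rewrite !hba !Hba; exact: trace_sqr_le.
Qed.

(** * The inequality at a minimum, in one chart *)

Section minimum_principle.
Context {R : realType}.
Variables (U : set 'rV[R]_2) (O : set ('rV[R]_2 * R)).
Hypothesis oU : open U.
Hypothesis oO : open O.
Hypothesis OU : forall z, O z -> U z.1.
Variables a b : 'I_2.
Hypothesis sumab : forall F : 'I_2 -> R, \sum_i F i = F a + F b.
Hypothesis ab : a != b.
Variables (h : 'I_2 -> 'I_2 -> 'rV[R]_2 -> R)
  (Gam : 'I_2 -> 'I_2 -> 'I_2 -> 'rV[R]_2 -> R).
Hypothesis sh : forall i j, smooth_open U (h i j).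
Hypothesis sGam : forall k i j, smooth_open U (Gam k i j).
Hypothesis hC : forall i j x, U x -> h i j x = h j i x.
Hypothesis GamC : forall k i j x, U x -> Gam k i j x = Gam k j i x.
Hypothesis metric_connection : forall k i j x, U x ->
  partial k (h i j) x
    = - (Gam i k a x * h a j x + Gam i k b x * h b j x)
      - (Gam j k a x * h i a x + Gam j k b x * h i b x).
Variable u : 'rV[R]_2 * R -> R.
Hypothesis su : smooth_open O u.
Hypothesis u_heat : forall x t, O (x, t) -> dtime u (x, t) =
  lapst a b h Gam u (x, t) + gradsq a b h (fun y => u (y, t)) x - u (x, t).
Variables (x : 'rV[R]_2) (t : R).
Hypothesis Oxt : O (x, t).
Hypothesis h_aa_gt0 : 0 < h a a x.
Hypothesis h_det_gt0 : 0 < h a a x * h b b x - h a b x * h a b x.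
Hypothesis gauss_ge0 : 0 <= gauss a b h Gam x.
Hypothesis gradsq_ge0 : 0 <= gradsq a b h (fun y => u (y, t)) x.
Hypothesis min_space : forall y, O (y, t) ->
  lapst a b h Gam u (x, t) <= lapst a b h Gam u (y, t).

Let W := [set y | O (y, t)].
Let ut y := u (y, t).
Let Q := lap a b h Gam ut.

Lemma open_slice : open W.
Proof.
apply: (@open_comp _ _ (fun y : 'rV[R]_2 => (y, t)) O) => // y _.
exact: (cvg_pair (@cvg_id _ (nbhs y)) (cvg_cst t)).
Qed.

Let WU y : W y -> U y. Proof. exact: OU. Qed.
Let sut : smooth_open W ut. Proof. exact: smooth_slice. Qed.

Let QE : Q = fun y => lapst a b h Gam u (y, t).
Proof. by apply/funext => y; exact: lap_slice. Qed.

Let sQ : smooth_open W Q.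
Proof.
rewrite QE.
exact: (@smooth_slice _ _ O _ t oO (smooth_lapst a b oU sh sGam oO OU su)).
Qed.

(** At a critical point the Christoffel terms drop out, leaving the trace of a nonnegative matrix
    against the positive definite [h]. *)
Lemma lap_at_min_ge0 : 0 <= lap a b h Gam Q x.
Proof.
have Qmin y : W y -> Q x <= Q y by rewrite !QE; exact: min_space.
have D0 k : partial k Q x = 0.
  by have [] := smooth_local_min (delta_mx 0 k) open_slice sQ Oxt Qmin.
have DD := second_derivative_test open_slice sumab ab sQ Oxt Qmin.
have := trace_psd_ge0 h_aa_gt0 h_det_gt0 DD.
by rewrite -(lap_critical Gam D0 (hC b a (WU Oxt)) (partialC b a open_slice sQ Oxt)).
Qed.

Lemma dtime_lapst_at_min :
  Q x * Q x - Q x <= lapst a b h Gam (dtime u) (x, t).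
Proof.
have oW := open_slice.
have Qmin y : W y -> Q x <= Q y by rewrite !QE; exact: min_space.
have D0 k : partial k Q x = 0.
  by have [] := smooth_local_min (delta_mx 0 k) oW sQ Oxt Qmin.
have shW i j : smooth_open W (h i j) := smooth_sub WU (sh i j).
have sGW k i j : smooth_open W (Gam k i j) := smooth_sub WU (sGam k i j).
have sw : smooth_open W (gradsq a b h ut).
  rewrite /gradsq /dot2.
  have s1 k := smooth_partial k sut.
  have sm i j := smooth_mul oW (smooth_mul oW (shW i j) (s1 i)) (s1 j).
  exact: (smooth_add oW (smooth_add oW (sm a a) (sm a b)) (smooth_add oW (sm b a) (sm b b))).
rewrite -lap_slice.
(* The equation for [u] is substituted on the whole slice, not only at [x], because two spatial
   derivatives are taken afterwards. *)
rewrite (lap_eq a b h Gam oW (w := fun y => Q y + gradsq a b h ut y - ut y) Oxt); last first.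
  by move=> y Wy; rewrite QE; exact: (u_heat Wy).
rewrite (lapDB a b h Gam oW sQ sw sut Oxt) -/Q.
have hCW i j y (Wy : W y) := hC i j (WU Wy).
have GCW k i j y (Wy : W y) := GamC k i j (WU Wy).
have mcW k i j y (Wy : W y) := metric_connection k i j (WU Wy).
rewrite (bochner oW shW sGW hCW GCW mcW sut Oxt).
rewrite (dot2_eq0 a b h (partial^~ ut) (w := partial^~ Q) D0).
have := lap_sqr_le h_aa_gt0 h_det_gt0 (hC b a (WU Oxt)) (hessC oW a b GCW sut b a Oxt).
rewrite -/Q expr2; move: lap_at_min_ge0 (mulr_ge0 gauss_ge0 gradsq_ge0).
rewrite -/ut -/Q.
move: (lap a b h Gam Q x) (Q x) (hess_sq a b h Gam ut x) (gauss a b h Gam x)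
  (gradsq a b h ut x) => l q H g w l0 gw0 qH.
by lra.
Qed.

Lemma minimum_value_ge0 : 0 < t ->
  (\forall s \near t, s <= t -> 
    t * lapst a b h Gam u (x, t) <= s * lapst a b h Gam u (x, s)) ->
  0 <= t * lapst a b h Gam u (x, t) + 1.
Proof.
move=> t0 tmin.
have dL := dtime_lapst a b h Gam oO su Oxt.
have dM := derive_mulf (is_derive_id t (1 : R)) dL.
have := derive_left_min_le0 dM tmin; rewrite mul1r.
have := dtime_lapst_at_min; rewrite QE.
move: (lapst a b h Gam u (x, t)) (lapst a b h Gam (dtime u) (x, t)) => q d qd td.
rewrite leNgt; apply/negP => tq.
have q0 : q < 0.
  by rewrite -(pmulr_rlt0 _ t0); apply: lt_trans (ltrN10 R); rewrite -subr_lt0 opprK.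
nra.
Qed.

End minimum_principle.

(** * Surfaces with an atlas *)

Section charts.
Context {R : realType} {M : topologicalType} {A : atlas R 2 M}.
Variable g : riemannian_metric A.
Implicit Types (i j : chart_index A) (p q : M).

Lemma chart_codP i p : chart_dom i p -> chart_cod i (chart i p).
Proof. by move=> ip; exists p. Qed.

Lemma chart_inv_dom i x : chart_cod i x -> chart_dom i (chart_inv i x).
Proof. by move=> [p ip <-]; rewrite chartK. Qed.

Lemma chart_invK i x : chart_cod i x -> chart i (chart_inv i x) = x.
Proof. by move=> [p ip <-]; rewrite chartK. Qed.

Lemma chart_atP p : chart_dom (chart_at A p) p.
Proof. exact: (projT2 (cid (chart_cover A p))). Qed.

Lemma open_overlap i j : open (chart i @` (chart_dom i `&` chart_dom j)).
Proof.
rewrite openE => _ [p [ip jp] <-].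
have cp := chart_codP ip.
have N1 : \forall x \near chart i p, chart_cod i x.
  by apply: open_nbhs_nbhs; split=> //; exact: chart_cod_open.
have N2 : \forall x \near chart i p, chart_dom j (chart_inv i x).
  have := chart_inv_continuous cp; apply; rewrite chartK//.
  by apply: open_nbhs_nbhs; split=> //; exact: chart_dom_open.
apply: filterS2 N1 N2 => x ix jx; exists (chart_inv i x).
  by split=> //; exact: chart_inv_dom.
exact: chart_invK.
Qed.

Variables a b : 'I_2.
Hypothesis sumab : forall F : 'I_2 -> R, \sum_i F i = F a + F b.
Hypothesis ab : a != b.

Let oU i : open (chart_cod i).
Proof. exact: chart_cod_open. Qed.
Let sG i : smooth_open (chart_cod i) (metric_coef g i).
Proof. exact: metric_smooth. Qed.
Let symG i x : chart_cod i x -> (metric_coef g i x)^T = metric_coef g i x.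
Proof. exact: (@Defs.metric_sym _ _ _ _ g i x). Qed.
Let posG i x : chart_cod i x -> forall v : 'rV[R]_2, v != 0 ->
  0 < (v *m metric_coef g i x *m v^T) 0 0.
Proof. exact: (@metric_posdef _ _ _ _ g i x). Qed.

(** Frees the Laplacian from the choice made by [chart_at]: the transition map on the overlap
    satisfies the assumptions of [local_laplacian_pullback]. *)
Lemma laplacian_chart (u : M -> R) i p :
  (forall j, smooth_open (chart_cod j) (u \o chart_inv j)) -> chart_dom i p ->
  laplacian g u p = local_laplacian (metric_coef g i) (u \o chart_inv i) (chart i p).
Proof.
move=> su ip; rewrite /laplacian; set j := chart_at A p.
have jp : chart_dom j p := chart_atP p.
pose W := chart i @` (chart_dom i `&` chart_dom j).
pose phi := chart j \o chart_inv i.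
have -> : chart j p = phi (chart i p) by rewrite /phi /= chartK.
have W1 : W `<=` chart_cod i by move=> _ [q [iq _] <-]; exact: chart_codP.
have W2 x : W x -> chart_cod j (phi x).
  by move=> [q [iq jq] <-]; rewrite /phi /= chartK//; exact: chart_codP.
have W3 x : W x -> metric_coef g i x =
    'J phi x *m metric_coef g j (phi x) *m ('J phi x)^T.
  move=> [q [iq jq] <-]; rewrite {2}/phi /= chartK//.
  exact: (metric_compat g iq jq).
have W4 x : W x -> (u \o chart_inv i) x = (u \o chart_inv j) (phi x).
  by move=> [q [iq jq] <-]; rewrite /phi /= !chartK.
have Wp : W (chart i p) by exists p.
exact: (esym (local_laplacian_pullback (@oU i) (@oU j) (@open_overlap i j)
  (@sG i) (@sG j) (@symG i) (@symG j) (@posG i) (@posG j) W1 W2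
  (@chart_transition _ _ _ A i j) W3 sumab ab (su i) (su j) W4 Wp)).
Qed.

Lemma laplacian_lap (u : M -> R) (v : 'rV[R]_2 -> R) (W : set 'rV[R]_2) i x :
  (forall j, smooth_open (chart_cod j) (u \o chart_inv j)) ->
  open W -> W x -> W `<=` chart_cod i ->
  (forall y, W y -> u (chart_inv i y) = v y) ->
  laplacian g u (chart_inv i x) =
  lap a b (invmetric (metric_coef g i)) (christoffel (metric_coef g i)) v x.
Proof.
move=> su oW Wx Wi uv; have ix := Wi x Wx.
rewrite (laplacian_chart su (chart_inv_dom ix)) (chart_invK ix).
rewrite (local_laplacianE (@oU i) (@sG i) (@symG i) (@posG i) sumab ab (su i) ix).
exact: (lap_eq a b _ _ oW Wx uv).
Qed.

End charts.

(** * Local representation of the solution and the equation for ln f *)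

Section log_heat.
Context {R : realType} {M : topologicalType} {A : atlas R 2 M}.
Variables (g : riemannian_metric A) (T : \bar R) (f : M -> R -> R).
Hypothesis f_smooth : smooth_spacetime A T f.
Hypothesis f_pos : forall (p : M) (t : R), 0 <= t -> (t%:E < T)%E -> 0 < f p t.
Hypothesis f_heat : forall (p : M) (t : R), 0 < t -> (t%:E < T)%E ->
  (f p)^`()%classic t = laplacian g (f^~ t) p - f p t * ln (f p t).
Variables a b : 'I_2.
Hypothesis sumab : forall F : 'I_2 -> R, \sum_i F i = F a + F b.
Hypothesis ab : a != b.
Implicit Types (i j : chart_index A) (p q : M) (t s : R).

Local Notation h i := (invmetric (metric_coef g i)).
Local Notation Gam i := (christoffel (metric_coef g i)).

(** At [t = 0] the neighbourhood [B] contains negative times, where [f] says nothing. The logarithm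
    of the extension [F] makes sense there because [F] is positive at the centre, hence nearby by
    continuity; [B] is shrunk accordingly. *)
Lemma spacetime_local i x t : chart_cod i x -> 0 <= t -> (t%:E < T)%E ->
  exists (B : set ('rV[R]_2 * R)) (F : 'rV[R]_2 * R -> R),
  [/\ open B, B (x, t), smooth_open B F,
      forall z, B z -> chart_cod i z.1 /\ 0 < F z &
      forall y s, B (y, s) -> 0 <= s -> (s%:E < T)%E ->
        f (chart_inv i y) s = F (y, s)].
Proof.
move=> ix t0 tT.
have [B [F [oB Bxt sF fF]]] := @f_smooth i (x, t) (conj ix (conj t0 tT)).
have F0 : 0 < F (x, t).
  by rewrite -(fF (x, t) (conj ix (conj t0 tT)) Bxt); exact: f_pos.
pose B0 := [set z | B z /\ (chart_cod i z.1 /\ 0 < F z)]°.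
exists B0, F; split.
- exact: open_interior.
- near=> z; split; [|split]; near: z.
  + exact: open_nbhs_nbhs.
  + have cf : {for (x, t), continuous (@fst 'rV[R]_2 R)} by exact: cvg_fst.
    by apply: cf; apply: open_nbhs_nbhs; split=> //; exact: chart_cod_open.
  + exact: (cvgr_gt _ (smooth_continuous sF Bxt)).
- by apply: smooth_sub sF => z /interior_subset[].
- by move=> z /interior_subset[_].
- move=> y s /interior_subset[Bys [iy _]] s0 sT.
  exact: (fF (y, s) (conj iy (conj s0 sT)) Bys).
Unshelve. all: by end_near.
Qed.

Lemma smooth_slice_f t j : 0 <= t -> (t%:E < T)%E ->
  smooth_open (chart_cod j) ((f^~ t) \o chart_inv j).
Proof.
move=> t0 tT; apply: smooth_local => x jx.
have [B [F [oB Bxt sF _ fF]]] := spacetime_local jx t0 tT.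
exists [set y | B (y, t)]; first by split=> //; exact: open_slice.
have E y : B (y, t) -> F (y, t) = ((f^~ t) \o chart_inv j) y.
  by move=> Byt; rewrite /= fF.
exact: (smooth_eq (@open_slice _ _ oB t) E (@smooth_slice _ _ B F t oB sF)).
Qed.

Lemma smooth_slice_lnf t j : 0 <= t -> (t%:E < T)%E ->
  smooth_open (chart_cod j) ((fun q => ln (f q t)) \o chart_inv j).
Proof.
move=> t0 tT; apply: (@smooth_ln _ _ _ _ ((f^~ t) \o chart_inv j)).
- exact: chart_cod_open.
- by move=> x jx; exact: f_pos.
- exact: smooth_slice_f.
Qed.


Lemma open_times : open [set s : R | 0 < s /\ (s%:E < T)%E].
Proof.
have -> : [set s : R | 0 < s /\ (s%:E < T)%E] =
    [set s : R | 0 < s] `&` [set s : R | (s%:E < T)%E] by [].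
apply: openI; first exact: open_gt.
case: T => [r||].
- by rewrite (_ : [set _ | _] = [set s : R | s < r]); [exact: open_lt|apply/seteqP; split=> s].
- by rewrite (_ : [set _ | _] = setT); [exact: openT|apply/seteqP; split=> s //= _; rewrite ltry].
- by rewrite (_ : [set _ | _] = set0); [exact: open0|apply/seteqP; split=> s].
Qed.

Definition logf q s : R := ln (f q s).

Lemma log_heat i x t : chart_cod i x -> 0 < t -> (t%:E < T)%E ->
  exists (B : set ('rV[R]_2 * R)) (u : 'rV[R]_2 * R -> R),
  [/\ open B, B (x, t), smooth_open B u, forall z, B z -> chart_cod i z.1 &
     forall y s, B (y, s) ->
     [/\ 0 < s /\ (s%:E < T)%E, logf (chart_inv i y) s = u (y, s),
         laplacian g (logf^~ s) (chart_inv i y) = lapst a b (h i) (Gam i) u (y, s),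
         (logf (chart_inv i y))^`()%classic s = dtime u (y, s) &
         dtime u (y, s) = lapst a b (h i) (Gam i) u (y, s)
           + gradsq a b (h i) (fun y => u (y, s)) y - u (y, s)]].
Proof.
move=> ix t0 tT.
have [B0 [F [oB0 B0xt sF0 B0i fF0]]] := spacetime_local ix (ltW t0) tT.
(* Restricting to positive times makes [F] agree with [f] on a full neighbourhood in time, so that
   the two-sided time derivatives agree as well. *)
pose B := B0 `&` [set z | 0 < z.2 /\ (z.2%:E < T)%E].
have oB : open B.
  apply: openI => //.
  apply: (@open_comp _ _ (@snd 'rV[R]_2 R) _ _ open_times) => z _.
  exact: cvg_snd.
have sF : smooth_open B F by apply: smooth_sub sF0 => z [].
have F0 z : B z -> 0 < F z by move=> [/B0i[]].
have Bi z : B z -> chart_cod i z.1 by move=> [/B0i[]].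
have fF y s : B (y, s) -> f (chart_inv i y) s = F (y, s).
  by move=> [Bys /= [s0 sT]]; apply: fF0 => //; exact: ltW.
exists B, (fun z => ln (F z)); split => //.
  exact: smooth_ln.
move=> y s Bys; have [_ /= [s0 sT]] := Bys.
pose W := [set y | B (y, s)].
have oW : open W := @open_slice _ _ oB s.
have Wi : W `<=` chart_cod i by move=> z /Bi.
have oBy : open [set s' | B (y, s')].
  apply: (@open_comp _ _ (fun s' : R => (y, s')) B) => // s' _.
  exact: (cvg_pair (cvg_cst y) (@cvg_id _ (nbhs s'))).
have Dt : (f (chart_inv i y))^`()%classic s = dtime F (y, s).
  rewrite derive1E /dtime -derive_slicer; apply: near_eq_derive.
  by apply: near_open oBy Bys _ => s' /fF.
have Dlog : dtime (fun z => ln (F z)) (y, s) = (F (y, s))^-1 * dtime F (y, s).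
  have dF : is_derive (y, s) (0, 1) F (dtime F (y, s)) := smooth_is_derive _ sF Bys.
  by have [_] := derive_lnf (F0 _ Bys) dF.
have lapF : laplacian g (f^~ s) (chart_inv i y) =
    lap a b (h i) (Gam i) (fun y => F (y, s)) y.
  have sfs j : smooth_open (chart_cod j) ((f^~ s) \o chart_inv j).
    exact: (smooth_slice_f (ltW s0) sT).
  have fW z : W z -> (f^~ s) (chart_inv i z) = (fun y => F (y, s)) z.
    exact: fF.
  exact: (laplacian_lap g sumab ab sfs oW Bys Wi fW).
split => //.
- by rewrite /logf fF.
- have slfs j : smooth_open (chart_cod j) ((logf^~ s) \o chart_inv j).
    exact: (smooth_slice_lnf (ltW s0) sT).
  have fW z : W z -> (logf^~ s) (chart_inv i z) = (fun y => ln (F (y, s))) z.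
    by move=> Wz; rewrite /logf fF.
  by rewrite (laplacian_lap g sumab ab slfs oW Bys Wi fW) -lap_slice.
- rewrite derive1E /dtime -derive_slicer; apply: near_eq_derive.
  by apply: near_open oBy Bys _ => s' Bys'; rewrite /logf fF.
- have := f_heat (chart_inv i y) s0 sT; rewrite Dt lapF fF// Dlog => ->.
  rewrite -lap_slice.
  have sFs : smooth_open W (fun y => F (y, s)) := @smooth_slice _ _ B F s oB sF.
  rewrite (lap_ln a b _ _ oW sFs (fun y Wy => F0 (y, s) Wy) Bys).
  have := lt0r_neq0 (F0 _ Bys).
  move: (F (y, s)) (lap _ _ _ _ _ _) (gradsq _ _ _ _ _) (ln _) => c l G w c0.
  by field.
Qed.

End log_heat.

(** * The global argument on the compact surface *)

Section compact_surface.
Context {R : realType} {M : topologicalType} {A : atlas R 2 M}.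
Variables (g : riemannian_metric A) (T : \bar R) (f : M -> R -> R).
Hypothesis M_compact : compact [set: M].
Hypothesis curvature_pos : forall p, 0 < scalar_curvature g p.
Hypothesis f_smooth : smooth_spacetime A T f.
Hypothesis f_pos : forall (p : M) (t : R), 0 <= t -> (t%:E < T)%E -> 0 < f p t.
Hypothesis f_heat : forall (p : M) (t : R), 0 < t -> (t%:E < T)%E ->
  (f p)^`()%classic t = laplacian g (f^~ t) p - f p t * ln (f p t).
Variables a b : 'I_2.
Hypothesis sumab : forall F : 'I_2 -> R, \sum_i F i = F a + F b.
Hypothesis ab : a != b.
Implicit Types (i j : chart_index A) (p q : M) (t s : R).

Local Notation h i := (invmetric (metric_coef g i)).
Local Notation Gam i := (christoffel (metric_coef g i)).
Local Notation logf := (logf f).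

Let oU i : open (chart_cod i).
Proof. exact: chart_cod_open. Qed.
Let sG i : smooth_open (chart_cod i) (metric_coef g i).
Proof. exact: metric_smooth. Qed.
Let symG i x : chart_cod i x -> (metric_coef g i x)^T = metric_coef g i x.
Proof. exact: (@Defs.metric_sym _ _ _ _ g i x). Qed.
Let posG i x : chart_cod i x -> forall v : 'rV[R]_2, v != 0 ->
  0 < (v *m metric_coef g i x *m v^T) 0 0.
Proof. exact: (@metric_posdef _ _ _ _ g i x). Qed.
Let sh i k l : smooth_open (chart_cod i) (h i k l).
Proof. exact: (smooth_invmetric (@oU i) (@sG i) (@symG i) (@posG i) sumab ab). Qed.
Let sGam i k l m : smooth_open (chart_cod i) (Gam i k l m).
Proof. exact: (smooth_christoffel (@oU i) (@sG i) (@symG i) (@posG i) sumab ab). Qed.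

(** Near [(p, t)] all Laplacians are computed in the one chart chosen at [p], where they are values
    of the smooth function [L]. Continuity is relative to the closed slab, since at time 0 only [L]
    extends to both sides. *)
Lemma laplacian_logf_continuous t0 : (t0%:E < T)%E ->
  {within [set: M] `*` `[0, t0]%classic,
    continuous (fun z : M * R => laplacian g (logf^~ z.2) z.1)}.
Proof.
move=> t0T; apply/subspace_continuousP => -[p t] [_] /=.
rewrite in_itv /= => /andP[t_ge0 t_le0].
have le_T s : s <= t0 -> (s%:E < T)%E.
  by move=> st0; apply: le_lt_trans t0T; rewrite lee_fin.
pose i := chart_at A p; have ip : chart_dom i p := chart_atP p.
have [B [F [oB Bxt sF Bi fF]]] :=
  spacetime_local f_smooth f_pos (chart_codP ip) t_ge0 (le_T t t_le0).
have BU z : B z -> chart_cod i z.1 by move=> /Bi[].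
have su : smooth_open B (fun z => ln (F z)).
  by apply: smooth_ln => // z /Bi[].
pose L := lapst a b (h i) (Gam i) (fun z => ln (F z)).
have sL : smooth_open B L := smooth_lapst a b (@oU i) (@sh i) (@sGam i) oB BU su.
have QL q s : chart_dom i q -> B (chart i q, s) -> 0 <= s <= t0 ->
    laplacian g (logf^~ s) q = L (chart i q, s).
  move=> iq Bqs /andP[s0 st0]; have sT := le_T s st0.
  have slfs j := smooth_slice_lnf f_smooth f_pos (j := j) s0 sT.
  have fW z : B (z, s) -> (logf^~ s) (chart_inv i z) = (fun y => ln (F (y, s))) z.
    by move=> Wz; rewrite /logf fF.
  have Wi : [set z | B (z, s)] `<=` chart_cod i by move=> z /BU.
  have := laplacian_lap g sumab ab slfs (@open_slice _ _ oB s) Bqs Wi fW.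
  by rewrite chartK// => ->; exact: lap_slice.
have c1 : {for (p, t), continuous (fun z : M * R => chart i z.1)}.
  apply: (@continuous_comp _ _ _ (@fst M R) (chart i)); first exact: cvg_fst.
  exact: chart_continuous.
have c2 : {for (p, t), continuous (@snd M R)} by exact: cvg_snd.
have cc : {for (p, t), continuous (fun z : M * R => (chart i z.1, z.2))}.
  exact: (cvg_pair c1 c2).
have cL : {for (p, t), continuous (fun z : M * R => L (chart i z.1, z.2))}.
  exact: (@continuous_comp _ _ _ (fun z : M * R => (chart i z.1, z.2)) L _ cc
    (smooth_continuous sL Bxt)).
have N1 : \forall z \near (p, t), chart_dom i z.1.
  have c0 : {for (p, t), continuous (@fst M R)} by exact: cvg_fst.
  by apply: c0; apply: open_nbhs_nbhs; split=> //; exact: chart_dom_open.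
have N2 : \forall z \near (p, t), B (chart i z.1, z.2).
  by apply: cc; exact: open_nbhs_nbhs.
have E : L (chart i p, t) = laplacian g (logf^~ t) p.
  by rewrite -(QL p t ip Bxt)// t_ge0.
suff C : laplacian g (logf^~ z.2) z.1
    @[z --> within ([set: M] `*` `[0, t0]%classic) (nbhs (p, t))] -->
    laplacian g (logf^~ t) p by exact: C.
rewrite -E.
have cLw : L (chart i z.1, z.2)
    @[z --> within ([set: M] `*` `[0, t0]%classic) (nbhs (p, t))] -->
    L (chart i p, t).
  apply: (@cvg_within_filter _ _ _ (nbhs (p, t))); exact: cL.
apply: (cvg_trans _ cLw).
apply: near_eq_cvg; rewrite near_withinE; apply: filterS2 N1 N2 => -[q s] /= iq Bqs.
by move=> [_]; rewrite /= in_itv /= => s01; rewrite QL.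
Qed.

Lemma laplacian_logf_ge0 p t : 0 < t -> (t%:E < T)%E ->
  0 <= t * laplacian g (logf^~ t) p + 1.
Proof.
move=> t0 tT.
pose K := [set: M] `*` `[0, t]%classic.
pose P (z : M * R) := z.2 * laplacian g (logf^~ z.2) z.1 + 1.
have Kpt : K (p, t) by split=> //=; rewrite in_itv /= lexx ltW.
have cK : compact K by apply: compact_setX => //; exact: segment_compact.
have cP : {within K, continuous P}.
  move=> z; apply: cvgD; last exact: cvg_cst.
  apply: cvgM; last exact: (laplacian_logf_continuous tT).
  by apply: continuous_subspaceT => {}z; exact: cvg_snd.
have [[p1 t1]] := compact_EVT_min (ex_intro _ _ Kpt) cK cP.
rewrite inE => -[_ /=]; rewrite in_itv /= => /andP[t1_ge0 t1_le] Pmin.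
apply: le_trans (Pmin (p, t) (mem_set Kpt)).
have {}Pmin q s : 0 <= s <= t -> P (p1, t1) <= P (q, s).
  by move=> st; apply: Pmin; rewrite inE; split=> //=; rewrite in_itv.
(* A minimum at time 0 has the value 1, whatever the Laplacian is there. *)
rewrite /P /=; move: t1_ge0; rewrite le_eqVlt => /predU1P[<-|t1_gt0].
  by rewrite mul0r add0r.
have t1T : (t1%:E < T)%E by apply: le_lt_trans tT; rewrite lee_fin.
pose i := chart_at A p1; have ip : chart_dom i p1 := chart_atP p1.
have ix := chart_codP ip.
have [B [u [oB Bxt su Bi H]]] := log_heat f_smooth f_pos f_heat sumab ab ix t1_gt0 t1T.
have [_ _ E _ _] := H _ _ Bxt.
rewrite chartK// in E; rewrite E.
have mc := metric_connection (@oU i) (@sG i) (@symG i) (@posG i) sumab ab.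
have hCi k l y : chart_cod i y -> h i k l y = h i l k y.
  exact: (invmetricC (@symG i) (@posG i) sumab ab).
have GCi k l m y : chart_cod i y -> Gam i k l m y = Gam i k m l y.
  exact: (christoffelC (@oU i) (@symG i) sumab).
apply: (minimum_value_ge0 (@oU i) oB Bi sumab ab (@sh i) (@sGam i) hCi GCi
  (fun k l m y => @mc k l m y) su _ Bxt _ _ _ _ _ t1_gt0).
- by move=> y s /H[].
- exact: (invmetric_aa_gt0 (@symG i) (@posG i) sumab ab).
- exact: (invmetric_det_gt0 (@symG i) (@posG i) sumab ab).
- have := curvature_pos p1; rewrite /scalar_curvature.
  rewrite (local_scalar_curvatureE (@oU i) (@sG i) (@symG i) (@posG i) sumab ab ix).
  by rewrite pmulr_rgt0// => /ltW.
- exact: (gradsq_ge0 (@symG i) (@posG i) sumab ab).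
(* At the fixed time [t1] the positive factor [t1] cancels, so minimality of [P] becomes minimality
   of the Laplacian in space. *)
- move=> y Byt; have [_ _ Ey _ _] := H _ _ Byt.
  have := Pmin (chart_inv i y) t1; rewrite t1_le ltW// => /(_ isT).
  by rewrite /P /= lerD2r ler_pM2l// E Ey.
(* [t1] may be the last time [t], so [P] is compared only with its values at earlier times. *)
- have oBx : open [set s | B (chart i p1, s)].
    apply: (@open_comp _ _ (fun s : R => (chart i p1, s)) B) => // s _.
    exact: (cvg_pair (cvg_cst (chart i p1)) (@cvg_id _ (nbhs s))).
  apply: (near_open oBx Bxt) => s Bs st1.
  have [[s0 _] _ Es _ _] := H _ _ Bs; rewrite chartK// in Es.
  have := Pmin p1 s; rewrite ltW//= (le_trans st1 t1_le) => /(_ isT).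
  by rewrite /P /= lerD2r E Es.
Qed.

(** The equation for ln f, rearranged. Gradient and norm are both defined in [chart_at A p]; working
    in that same chart makes their invariance unnecessary. *)
Lemma logf_evolution p t : 0 < t -> (t%:E < T)%E ->
  (logf p)^`()%classic t - tangent_norm g p (grad g (logf^~ t) p) ^+ 2 + logf p t
  = laplacian g (logf^~ t) p.
Proof.
move=> t0 tT; rewrite /tangent_norm /grad.
pose i := chart_at A p; have ip : chart_dom i p := chart_atP p.
have ix := chart_codP ip; rewrite -/i.
rewrite (local_norm_gradE (@symG i) (@posG i) sumab ab _ ix).
have [B [u [oB Bxt su Bi H]]] := log_heat f_smooth f_pos f_heat sumab ab ix t0 tT.
have [_ Eu El Ed Eh] := H _ _ Bxt.
rewrite chartK// in Eu El Ed; rewrite Ed Eh El Eu.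
have -> : gradsq a b (h i) (logf^~ t \o chart_inv i) (chart i p)
    = gradsq a b (h i) (fun y => u (y, t)) (chart i p).
  apply: (gradsq_eq a b _ (@open_slice _ _ oB t) Bxt) => y Byt.
  by have [_] := H _ _ Byt.
by rewrite addrAC subrK addrK.
Qed.

End compact_surface.

Unset Implicit Arguments.

Theorem corollary1p2 (R : realType) (M : topologicalType) (A : atlas R 2%N M)
    (g : riemannian_metric A) (T : \bar R) (f : M -> R -> R)
    (M_compact : compact [set: M]) (M_hausdorff : hausdorff_space M)
    (curvature_pos : forall p, 0 < scalar_curvature g p)
    (f_smooth : smooth_spacetime A T f)
    (f_pos : forall (p : M) (t : R), 0 <= t -> (t%:E < T)%E -> 0 < f p t)
    (f_heat : forall (p : M) (t : R), 0 < t -> (t%:E < T)%E ->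
       (f p)^`()%classic t = laplacian g (f^~ t) p - f p t * ln (f p t)) :
  forall (p : M) (t : R), 0 < t -> (t%:E < T)%E ->
    let lnf := fun (q : M) (s : R) => ln (f q s) in
    (lnf p)^`()%classic t
      - tangent_norm g p (grad g (lnf^~ t) p) ^+ 2 + lnf p t + t^-1
      = laplacian g (lnf^~ t) p + t^-1
    /\ 0 <= laplacian g (lnf^~ t) p + t^-1.
Proof.
move=> p t t0 tT lnf.
(* Only here do the two abstract indices become 0 and 1. *)
have sum01 (F : 'I_2 -> R) : \sum_i F i = F 0 + F 1 := sum2E F.
have ne01 : (0 : 'I_2) != 1 by [].
split.
  by congr (_ + _); exact: (logf_evolution f_smooth f_pos f_heat sum01 ne01).
have := laplacian_logf_ge0 M_compact curvature_pos f_smooth f_pos f_heat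
  sum01 ne01 p t0 tT.
have tV : t * t^-1 = 1 by rewrite divff// gt_eqF.
by rewrite -{1}tV -mulrDr pmulr_rge0.
Qed.
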